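(* Let $I\subset\mathbb{R}$ be an open interval, $\Lambda\subset\mathbb{R}^2$ an open subset, $\Omega\subset\mathcal{H}$ an open subset of the Heisenberg group, and let $\Phi:I\times\Lambda\to\Omega$, $(s,p)\mapsto\Phi(s,p)$, be a $C^2$-diffeomorphism such that for every $p\in\Lambda$ the curve $\Phi(\cdot,p)$ is legendrian. Put $\Gamma=\{\Phi(\cdot,p)\ |\ p\in\Lambda\}$. Let $q$ be a quadratic differential on $\Omega$ satisfying $B_2q=0$ and such that every curve in $\Gamma$ is a horizontal trajectory of $q$. For $(z,t)\in\Omega$ let $l_\Gamma(z,t)$ be the $q$-length $l_q(\Phi(\cdot,p))$ of the curve of $\Gamma$ passing through $(z,t)$, where $p\in\Lambda$ is the $\Lambda$-component of $\Phi^{-1}(z,t)$. Assume that $l_\Gamma$ takes values in $]0,+\infty[$. Then $$M_4(\Gamma)=\int_\Omega\frac{|q|^2}{(l_\Gamma)^4}\,\mathrm{d}L^3 .$$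
   Context: The Heisenberg group $\mathcal{H}$ is $\mathbb{C}\times\mathbb{R}$ (coordinates $(z,t)$) with group law $(z,t)(z',t')=(z+z',\,t+t'+2\,\mathrm{Im}(z\overline{z}'))$. Let $Z=\frac{\partial}{\partial z}+i\overline z\frac{\partial}{\partial t}$ and $\overline Z=\frac{\partial}{\partial\overline z}-iz\frac{\partial}{\partial t}$; the CR structure is spanned by $Z$, and the contact distribution is the kernel of $\omega=\mathrm{d}t-i\overline z\,\mathrm{d}z+iz\,\mathrm{d}\overline z$. A $C^1$ curve $\gamma=(\gamma_1,\gamma_2):I\to\mathcal{H}$ is legendrian if it is everywhere tangent to the contact distribution, i.e. $\dot\gamma_2(s)=-2\,\mathrm{Im}(\overline{\gamma_1(s)}\,\dot\gamma_1(s))$ for all $s$. A quadratic differential on an open set $\Omega\subset\mathcal{H}$ is a class $[q\,\mathrm{d}z^2]_\omega$ modulo the contact form $\omega$, with $q:\Omega\to\mathbb{C}$ smooth ($C^\infty$); it is identified with the function $q$. The operator $B_2$ on $\Omega$ is $B_2[q\,\mathrm{d}z^2]_\omega=\big(\overline Z(|q|^2)+\overline q\,\overline Zq\big)\,\omega\wedge\mathrm{d}\overline z\otimes\omega$, so $B_2q=0$ means $\overline Z(|q|^2)+\overline q\,\overline Zq=0$ on $\Omega$. A legendrian curve $\gamma:I\to\Omega$ is a horizontal trajectory of $q$ if $q(\gamma(s))\,\dot\gamma_1(s)^2$ is real and $>0$ for all $s\in I$. Its $q$-length is $l_q(\gamma)=\int_I\sqrt{|q(\gamma(s))|}\,|\dot\gamma_1(s)|\,\mathrm{d}s$.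 For a family $\Gamma$ of legendrian curves in $\Omega$, $\mathrm{adm}(\Gamma)$ is the set of Borel measurable functions $\rho:\Omega\to[0,\infty]$ such that $\int_a^b\rho(\gamma(s))\,|\dot\gamma_1(s)|\,\mathrm{d}s\ge1$ for every curve $\gamma:\,]a,b[\,\to\Omega$ in $\Gamma$. The $4$-modulus of $\Gamma$ is $M_4(\Gamma)=\inf_{\rho\in\mathrm{adm}(\Gamma)}\int_\Omega\rho^4\,\mathrm{d}L^3$, where $L^3$ is Lebesgue measure on $\mathbb{R}^3\cong\mathbb{C}\times\mathbb{R}$. Equalities between integrals and moduli are in $[0,+\infty]$. *)

(* Defs.v *)
From HB Require Import structures.
From mathcomp Require Import all_boot all_order all_algebra.
From mathcomp Require Import complex.
From mathcomp Require Import all_classical all_reals all_analysis.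
From mathcomp Require Import measurable_realfun.

Set Implicit Arguments.
Unset Strict Implicit.
Unset Printing Implicit Defensive.

Import Order.TTheory GRing.Theory Num.Theory.
Import numFieldNormedType.Exports.

Local Open Scope classical_set_scope.
Local Open Scope ring_scope.
Local Open Scope complex_scope.

(* A point (z, t) of the Heisenberg group is the triple ((x, y), t) with
   z = x + i y. *)
Notation heisenberg R := ((R * R) * R)%type.

Definition zcoord (R : realType) (w : heisenberg R) : R[i] := w.1.1 +i* w.1.2.

Definition lebesgue3 (R : realType) :=
  ((@lebesgue_measure R \x @lebesgue_measure R) \x @lebesgue_measure R)%E.

(* f is C^k on the open set D. For k >= 1: f is differentiable on D and all its
   directional derivatives are C^(k-1); between finite-dimensional spaces this
   is the usual notion. The values of f outside D are irrelevant. *)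
Fixpoint Cn (R : realType) (V W : normedModType R) (k : nat) (D : set V)
    (f : V -> W) : Prop :=
  match k with
  | 0 => forall x, D x -> {for x, continuous f}
  | k'.+1 => (forall x, D x -> differentiable f x) /\
             (forall v : V, Cn k' D (fun x => 'D_v f x))
  end.

Definition Cn_diffeomorphism (R : realType) (V W : normedModType R) (k : nat)
    (D : set V) (E : set W) (f : V -> W) : Prop :=
  [/\ set_bij D E f, Cn k D f & Cn k E (pinv D f)].

Definition smoothC (R : realType) (Omega : set (heisenberg R))
    (q : heisenberg R -> R[i]) : Prop :=
  forall k : nat, Cn k Omega (fun w => complex.Re (q w) : R) /\
                  Cn k Omega (fun w => complex.Im (q w) : R).

Definition dirderivC (R : realType) (v : heisenberg R)
    (f : heisenberg R -> R[i]) (w : heisenberg R) : R[i] :=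
  'D_v (fun u => complex.Re (f u) : R) w +i* 'D_v (fun u => complex.Im (f u) : R) w.

(* The first summand is the Wirtinger derivative (d/dx + i d/dy) / 2. *)
Definition Zbar (R : realType) (f : heisenberg R -> R[i])
    (w : heisenberg R) : R[i] :=
  (dirderivC ((1, 0), 0) f w + 'i * dirderivC ((0, 1), 0) f w) / 2%:R
  - 'i * zcoord w * dirderivC ((0, 0), 1) f w.

(* The coefficient of (omega /\ d zbar) (x) omega in B_2 [q dz^2]. *)
Definition B2 (R : realType) (q : heisenberg R -> R[i])
    (w : heisenberg R) : R[i] :=
  Zbar (fun u => `|q u| ^+ 2) w + (q w)^* * Zbar q w.

(* A curve is given by its domain, an open interval I, and a function of which
   only the restriction to I is relevant; accordingly a family of curves is a
   set of pairs (I, gamma). *)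
Definition zvelocity (R : realType) (gamma : R -> heisenberg R) (s : R) : R[i] :=
  zcoord (derive1 gamma s).

Definition legendrian (R : realType) (I : set R)
    (gamma : R -> heisenberg R) : Prop :=
  Cn 1 I gamma /\
  forall s, I s -> (derive1 gamma s).2 =
    - 2%:R * complex.Im ((zcoord (gamma s))^* * zvelocity gamma s).

(* The order on R[i] makes 0 < c mean: c is real and positive. *)
Definition horizontal_trajectory (R : realType) (Omega : set (heisenberg R))
    (q : heisenberg R -> R[i]) (I : set R) (gamma : R -> heisenberg R) : Prop :=
  [/\ legendrian I gamma, (forall s, I s -> Omega (gamma s)) &
      forall s, I s -> 0 < q (gamma s) * zvelocity gamma s ^+ 2].

Definition q_length (R : realType) (q : heisenberg R -> R[i]) (I : set R)
    (gamma : R -> heisenberg R) : \bar R :=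
  (\int[lebesgue_measure]_(s in I)
     (Num.sqrt (Normc.normc (q (gamma s))) *
      Normc.normc (zvelocity gamma s))%:E)%E.

Definition adm (R : realType) (Omega : set (heisenberg R))
    (Gamma : set (set R * (R -> heisenberg R))) :
    set (heisenberg R -> \bar R) :=
  [set rho : heisenberg R -> \bar R | [/\ measurable_fun Omega rho,
     (forall w, Omega w -> (0 <= rho w)%E) &
     forall I gamma, Gamma (I, gamma) ->
       (1 <= \int[lebesgue_measure]_(s in I)
               (rho (gamma s) * (Normc.normc (zvelocity gamma s))%:E))%E]].

Definition modulus4 (R : realType) (Omega : set (heisenberg R))
    (Gamma : set (set R * (R -> heisenberg R))) : \bar R :=
  ereal_inf [set (\int[@lebesgue3 R]_(w in Omega) (rho w ^+ 4))%E
            | rho in adm Omega Gamma].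

Definition curve_family (R : realType) (I : set R) (Lambda : set (R * R))
    (Phi : R * (R * R) -> heisenberg R) : set (set R * (R -> heisenberg R)) :=
  [set (I, fun s => Phi (s, p)) | p in Lambda].

Definition l_Gamma (R : realType) (q : heisenberg R -> R[i]) (I : set R)
    (Lambda : set (R * R)) (Phi : R * (R * R) -> heisenberg R)
    (w : heisenberg R) : \bar R :=
  q_length q I (fun s => Phi (s, (pinv (I `*` Lambda) Phi w).2)).

(* Main.v *)
(* Let u be the field of tangent vectors of the curves of Gamma, with horizontal
   component u_z, and let W = |q|^2 / (|q|^(1/2) |u_z|). Since the curves are
   horizontal trajectories, (W u_z)^2 = |q|^2 conj q, and B_2 q = 0 then says that
   the field W u is divergence free. Testing this against functions of the form
   phi(s) psi(p) composed with Phi^-1 shows that the image of W L^3 under Phi^-1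
   is invariant under translations in s, hence equal to ds x nu on I x Lambda for
   some measure nu. This gives
     int_Omega h dL^3 = int_Lambda (int_I h(Phi(s, p)) / W(Phi(s, p)) ds) dnu(p)
   without any Jacobian. The extremality of rho0 = |q|^(1/2) / l_Gamma can now be
   checked on each curve separately, by Young's inequality
   4 c^3 r <= r^4 + 3 c^4 with c = rho0 and r = rho. *)

Require Import Defs.
From HB Require Import structures.
From mathcomp Require Import all_boot all_order all_algebra.
From mathcomp Require Import complex.
From mathcomp Require Import all_classical all_reals all_analysis.
From mathcomp Require Import measurable_realfun.
From mathcomp Require Import ring lra.

Set Implicit Arguments.
Unset Strict Implicit.
Unset Printing Implicit Defensive.

Import Order.TTheory GRing.Theory Num.Theory.
Import numFieldNormedType.Exports.

Local Open Scope classical_set_scope.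
Local Open Scope ring_scope.

(** The weight [W] answers two demands at once. In Young's inequality with c = |q|^(1/2) / l_Gamma,
    multiplied by 1 / W, one has c^3 / W = |u_z| / l_Gamma^3, so the linear term becomes the
    integrand of the [rho]-length, while c^4 / W = |q|^(1/2) |u_z| / l_Gamma^4 integrates to
    l_Gamma^-3 along a curve. On the other hand W u_z is a square root of |q|^2 conj q, and Z(|q|^2
    conj q) is the conjugate of Zbar(|q|^2 q) = q (Zbar |q|^2 + conj q Zbar q), that is, of q B_2 q.
    Hence Z(W u_z) = 0. The curves being legendrian, W u = A X + B Y with Z = (X - iY) / 2, so the
    divergence of W u is XA + YB, the real part of 2 Z(W u_z). The fields u and W are C^1, which is
    what a divergence needs. Its vanishing is used in weak form: the integral of a coordinate
    derivative of a compactly supported function is 0, by Fubini and the one-variable theorem.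
    Invariance in s follows because two functions of s with equal integrals differ by the derivative
    of a compactly supported function. *)

(** * Open sets are measurable for the product sigma-algebras *)

(** [M] is any family of sets, so that the notion passes from the factors to a product through
    rectangles alone; the sigma-algebra properties enter only in [basis_open]. *)
Definition countable_measurable_basis (T : topologicalType) (M : set (set T)) :=
  exists B : nat -> set T, (forall n, M (B n)) /\
    forall x U, nbhs x U -> exists n, B n x /\ B n `<=` U.

(** Rational endpoints, enumerated through [unpickle]. The closed interval is asked to lie in [U]
    because the covers by compact boxes below rely on it. *)
Lemma open_itv_basis (R : realType) : exists ab : nat -> R * R,
  forall (x : R) U, nbhs x U -> exists n,
    (ab n).1 < x < (ab n).2 /\ `[(ab n).1, (ab n).2] `<=` U.
Proof.
exists (fun n => if unpickle n is Some (a, b) then (ratr a, ratr b) : R * R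
  else (0, 0)).
move=> x U /nbhs_ballP[e /= e0 xU].
have [a] := @rat_in_itvoo R (x - e) x ltac:(lra).
rewrite in_itv/= => /andP[ea ax].
have [b] := @rat_in_itvoo R x (x + e) ltac:(lra).
rewrite in_itv/= => /andP[xb be].
exists (pickle (a, b)); rewrite pickleK/=; split; first exact/andP.
move=> y/=; rewrite in_itv/= => /andP[ay yb].
by apply: xU; rewrite /ball/= ltr_norml; apply/andP; split; lra.
Qed.

Lemma basis_realType (R : realType) :
  @countable_measurable_basis R (@measurable _ (measurableTypeR R)).
Proof.
have [ab abP] := open_itv_basis R.
exists (fun n => `](ab n).1, (ab n).2[%classic); split => [n|x U xU].
  exact: measurable_itv.
have [n [abx abU]] := abP x U xU; exists n; split; first by rewrite /= in_itv.
by apply: subset_trans abU; exact: subset_itv_oo_cc.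
Qed.

Lemma basis_prod (T1 T2 : topologicalType) (M1 : set (set T1))
    (M2 : set (set T2)) (M : set (set (T1 * T2))) :
  countable_measurable_basis M1 -> countable_measurable_basis M2 ->
  (forall A B, M1 A -> M2 B -> M (A `*` B)) -> countable_measurable_basis M.
Proof.
move=> [B1 [mB1 B1P]] [B2 [mB2 B2P]] M12.
exists (fun n => if unpickle n is Some (i, j) then B1 i `*` B2 j
  else B1 0%N `*` B2 0%N); split.
  by move=> n; case: unpickle => [[i j]|]; exact: M12.
move=> [x y] U [[/= V1 V2] [/= xV1 yV2] VU].
have [i [Bx BV1]] := B1P _ _ xV1.
have [j [By BV2]] := B2P _ _ yV2.
exists (pickle (i, j)); rewrite pickleK; split => // -[a b] [/= Ba Bb].
by apply: VU; split; [exact: BV1|exact: BV2].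
Qed.

Lemma basis_open (T : topologicalType) (M : set (set T)) (U : set T) :
  M set0 -> (forall F : nat -> set T, (forall n, M (F n)) -> M (\bigcup_n F n)) ->
  countable_measurable_basis M -> open U -> M U.
Proof.
move=> M0 MU [B [mB BP]] oU.
have -> : U = \bigcup_n (if pselect (B n `<=` U) then B n else set0).
  apply/seteqP; split => [x Ux|x [n _]]; last first.
    by case: pselect => // BU; exact: BU.
  have [n [Bx BU]] := BP x U (open_nbhs_nbhs (conj oU Ux)).
  by exists n => //; case: pselect.
apply: (MU (fun n => if pselect (B n `<=` U) then B n else set0)) => n.
by case: (pselect (B n `<=` U)) => ?; [exact: mB|exact: M0].
Qed.

Lemma basis_plane (R : realType) :
  @countable_measurable_basis (R * R)%type (@measurable _ (measurableTypeR R * measurableTypeR R)%type).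
Proof.
apply: basis_prod; [exact: basis_realType|exact: basis_realType|].
by move=> A B mA mB; exact: measurableX.
Qed.

Lemma open_measurable_plane (R : realType) (U : set (R * R)) : open U -> measurable U.
Proof.
apply: basis_open; [exact: measurable0| |exact: basis_plane].
exact: bigcupT_measurable.
Qed.

Lemma open_measurable_heisenberg (R : realType) (U : set (heisenberg R)) :
  open U -> measurable U.
Proof.
apply: basis_open; [exact: measurable0|exact: bigcupT_measurable|].
apply: basis_prod; [exact: basis_plane|exact: basis_realType|].
by move=> A B mA mB; exact: measurableX.
Qed.

Lemma open_measurable_param (R : realType) (U : set (R * (R * R))) :
  open U -> measurable U.
Proof.
apply: basis_open; [exact: measurable0|exact: bigcupT_measurable|].
apply: basis_prod; [exact: basis_realType|exact: basis_plane|].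
by move=> A B mA mB; exact: measurableX.
Qed.

Lemma open_preimage_on (T U : topologicalType) (D : set T) (f : T -> U) (V : set U) :
  open D -> {in D, continuous f} -> open V -> open (D `&` f @^-1` V).
Proof.
move=> oD cf oV; rewrite openE => x [Dx Vfx]; rewrite /interior.
apply: filterI; first exact: open_nbhs_nbhs.
by apply: cf; [rewrite inE|exact: open_nbhs_nbhs].
Qed.

Lemma open_continuous_measurable_heisenberg (R : realType) (D : set (heisenberg R))
    (f : heisenberg R -> R) :
  open D -> {in D, continuous f} -> measurable_fun D f.
Proof.
move=> oD cf mD; apply: (measurability _ (RGenOpens.measurableE R)) => //.
move=> /= _ [_ [a [b ->]] <-]; apply: open_measurable_heisenberg.
by apply: open_preimage_on => //; exact: interval_open.
Qed.

Lemma open_continuous_measurable_plane (R : realType) (D : set (R * R))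
    (f : R * R -> R) :
  open D -> {in D, continuous f} -> measurable_fun D f.
Proof.
move=> oD cf mD; apply: (measurability _ (RGenOpens.measurableE R)) => //.
move=> /= _ [_ [a [b ->]] <-]; apply: open_measurable_plane.
by apply: open_preimage_on => //; exact: interval_open.
Qed.

Lemma open_continuous_measurable_param (R : realType) (D : set (R * (R * R)))
    (f : R * (R * R) -> R) :
  open D -> {in D, continuous f} -> measurable_fun D f.
Proof.
move=> oD cf mD; apply: (measurability _ (RGenOpens.measurableE R)) => //.
move=> /= _ [_ [a [b ->]] <-]; apply: open_measurable_param.
by apply: open_preimage_on => //; exact: interval_open.
Qed.

(* [R] itself and [measurableTypeR R] carry different measurable structures up to
   conversion, so products are always formed from the latter. *)
Notation plane R := (measurableTypeR R * measurableTypeR R)%type.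
Notation param R :=
  (measurableTypeR R * (measurableTypeR R * measurableTypeR R))%type.

(** * Measures on the parameter space are determined by boxes *)

(** The endpoints are in no prescribed order: empty intersections are then boxes too, and the class
    is closed under intersection without case distinctions. *)
Definition open_box (R : realType) : set (set (param R)) :=
  [set A | exists a b c d e f : R,
     A = `]a, b[%classic `*` (`]c, d[%classic `*` `]e, f[%classic)].

Lemma setI_itvoo (R : realType) (a b c d : R) :
  `]a, b[%classic `&` `]c, d[%classic = `]Num.max a c, Num.min b d[%classic.
Proof.
apply/seteqP; split => x/=; rewrite !in_itv/= gt_max lt_min.
  by move=> [/andP[-> ->] /andP[-> ->]].
by move=> /andP[/andP[-> ->] /andP[-> ->]].
Qed.

Lemma setXI (T1 T2 : Type) (A C : set T1) (B D : set T2) :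
  (A `*` B) `&` (C `*` D) = (A `&` C) `*` (B `&` D).
Proof.
by apply/seteqP; split => -[x y]/= => [[[? ?] [? ?]]|[[? ?] [? ?]]].
Qed.

Lemma open_box_setI (R : realType) : setI_closed (@open_box R).
Proof.
move=> _ _ [a [b [c [d [e [f ->]]]]]] [a' [b' [c' [d' [e' [f' ->]]]]]].
rewrite !setXI !setI_itvoo; do 6 eexists; reflexivity.
Qed.

Lemma open_box_measurable (R : realType) (A : set (R * (R * R))) :
  open_box A -> measurable A.
Proof.
by move=> [a [b [c [d [e [f ->]]]]]]; apply: measurableX => //; apply: measurableX.
Qed.

Definition centered_box (R : realType) (n : nat) : set (param R) :=
  let J := `](- n%:R), n%:R[%classic in J `*` (J `*` J).

Lemma centered_box_cover (R : realType) : \bigcup_n (@centered_box R n) = setT.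
Proof.
apply/seteqP; split => // -[s [p r]] _.
exists (Num.truncn (`|s| + `|p| + `|r|)).+1 => //.
have : `|s| + `|p| + `|r| < (Num.truncn (`|s| + `|p| + `|r|)).+1%:R by exact: truncnS_gt.
set N := _%:R => sN; have := (normr_ge0 s, normr_ge0 p, normr_ge0 r).
move=> [[? ?] ?].
by split; [|split]; rewrite /= in_itv/= -ltr_norml; lra.
Qed.

(** For the sigma-algebra generated by the boxes each coordinate is measurable, since the preimage
    of a ray is a countable union of boxes. *)
Lemma open_box_generates (R : realType) :
  @measurable _ (param R)
  = <<s @open_box R >>.
Proof.
apply/seteqP; split; last first.
  apply: smallest_sub; first exact: sigma_algebra_measurable.
  by move=> A; exact: open_box_measurable.
pose T := g_sigma_algebraType (@open_box R).
have gen (f : T -> R) : (forall x : R, exists g : nat -> nat -> set T,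
    (forall i n, open_box (g i n)) /\ f @^-1` `]x, +oo[ = \bigcup_n \bigcup_i g n i) -> measurable_fun setT f.
  move=> fP _; apply: (measurability _ (RGenOInfty.measurableE R)) => //.
  move=> _ [_ [x ->] <-]; rewrite setTI.
  have [g [gbox ->]] := fP x.
  apply: bigcupT_measurable => n; apply: bigcupT_measurable => i.
  by apply: sub_sigma_algebra; exact: gbox.
have rayE (x : R) : `]x, +oo[%classic = \bigcup_n `]x, n%:R[%classic.
  apply/seteqP; split => [y|y [n _]]/=; rewrite !in_itv/= ?andbT; last by case/andP.
  move=> xy; exists (Num.truncn y).+1 => //=.
  by rewrite in_itv/= xy; exact: truncnS_gt.
have m1 : measurable_fun setT (fun x : T => x.1).
  apply: gen => x; exists (fun n i => `]x, n%:R[%classic `*`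
    (`](- i%:R), i%:R[%classic `*` `](- i%:R), i%:R[%classic)).
  split; first by move=> n i; do 6 eexists; reflexivity.
  rewrite rayE; apply/seteqP; split => -[s pr]/=; last first.
    by move=> [n _ [i _ [/= sn _]]]; exists n.
  move=> [n _ sn]; exists n => //.
  have : (\bigcup_n (@centered_box R n)) (s, pr) by rewrite centered_box_cover.
  by move=> [i _ [/= _ [pi ri]]]; exists i.
have m2 : measurable_fun setT (fun x : T => x.2.1).
  apply: gen => x; exists (fun n i => `](- i%:R), i%:R[%classic `*`
    (`]x, n%:R[%classic `*` `](- i%:R), i%:R[%classic)).
  split; first by move=> n i; do 6 eexists; reflexivity.
  rewrite rayE; apply/seteqP; split => -[s pr]/=; last first.
    by move=> [n _ [i _ [/= _ [sn _]]]]; exists n.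
  move=> [n _ sn]; exists n => //.
  have : (\bigcup_n (@centered_box R n)) (s, pr) by rewrite centered_box_cover.
  by move=> [i _ [/= si [pi ri]]]; exists i.
have m3 : measurable_fun setT (fun x : T => x.2.2).
  apply: gen => x; exists (fun n i => `](- i%:R), i%:R[%classic `*`
    (`](- i%:R), i%:R[%classic `*` `]x, n%:R[%classic)).
  split; first by move=> n i; do 6 eexists; reflexivity.
  rewrite rayE; apply/seteqP; split => -[s pr]/=; last first.
    by move=> [n _ [i _ [/= _ [_ sn]]]]; exists n.
  move=> [n _ sn]; exists n => //.
  have : (\bigcup_n (@centered_box R n)) (s, pr) by rewrite centered_box_cover.
  by move=> [i _ [/= si [pi ri]]]; exists i.
(* The triple of the coordinates is the identity map, so its measurability says that every
   product-measurable set is generated by boxes. *)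
move=> A mA; have := measurable_fun_pair m1 (measurable_fun_pair m2 m3).
move=> /(_ measurableT A mA); rewrite setTI /=.
by congr (<<s _ >> _); apply/seteqP; split => -[s [p r]].
Qed.

(** Uniqueness on a pi-system asks for finiteness along an exhausting sequence of boxes. Restricting
    both measures to [D] provides it, whatever happens on boxes that leave [D]. *)
Lemma eq_measure_in_box (R : realType) (m1 m2 : {measure set (param R) -> \bar R})
    (D : set (param R)) : measurable D -> (m1 D < +oo)%E ->
  (forall A, open_box A -> m1 (A `&` D) = m2 (A `&` D)) ->
  forall A, measurable A -> A `<=` D -> m1 A = m2 A.
Proof.
move=> mD Doo m12 A mA AD.
rewrite -(setIidl AD).
suff : mrestr m1 mD A = mrestr m2 mD A by [].
apply: (@measure_unique _ R (param R) (@open_box R) (@centered_box R)) => //.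
- exact: open_box_generates.
- exact: open_box_setI.
- by move=> n; do 6 eexists; reflexivity.
- exact: centered_box_cover.
- move=> k; apply: le_lt_trans Doo; apply: le_measure; rewrite ?inE//.
  apply: measurableI => //; apply: open_box_measurable.
  by do 6 eexists; reflexivity.
Qed.

Lemma eq_measure_bigcup d (T : measurableType d) (R : realType)
    (m1 m2 : {measure set T -> \bar R}) (U : nat -> set T) :
  (forall n, measurable (U n)) ->
  (forall n A, measurable A -> A `<=` U n -> m1 A = m2 A) ->
  forall A, measurable A -> A `<=` \bigcup_n U n -> m1 A = m2 A.
Proof.
move=> mU m12 A mA AU.
pose F n := A `&` U n.
have mF n : measurable (F n) by exact: measurableI.
have mDF n : measurable (seqDU F n).
  by apply: measurableD => //; exact: bigsetU_measurable.
have -> : A = \bigcup_n seqDU F n.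
  by rewrite -seqDU_bigcup_eq -setI_bigcupr; apply/esym/setIidl.
rewrite !measure_bigcup//; apply: eq_eseriesr => n _.
apply: (m12 n) => //.
by apply: (subset_trans (@subset_seqDU _ _ _)); exact: subIsetr.
Qed.

(** * Measures given by a density, and their images *)

Section density.
Import HBNNSimple.

(** The formula holds for indicators by definition of the measure, then for simple functions by
    linearity, then for all [k] by monotone convergence. *)
Lemma density_measure d (T : measurableType d) (R : realType)
    (mu : {measure set T -> \bar R}) (w : T -> R) :
  measurable_fun setT w -> (forall x, 0 <= w x) ->
  exists m : {measure set T -> \bar R}, forall k : T -> \bar R,
    measurable_fun setT k -> (forall y, 0 <= k y)%E ->
    (\int[m]_y k y = \int[mu]_x (k x * (w x)%:E))%E.
Proof.
move=> mw w0.
have mw' : measurable_fun setT (EFin \o w) by exact/measurable_EFinP.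
pose m0 (A : set T) := (\int[mu]_(x in A) (w x)%:E)%E.
have m00 : m0 set0 = 0%E by rewrite /m0 integral_set0.
have m0ge0 A : (0 <= m0 A)%E by apply: integral_ge0 => x _; rewrite lee_fin.
have m0s : semi_sigma_additive m0.
  by apply: semi_sigma_additive_nng_induced => // x; rewrite lee_fin.
pose m : {measure set T -> \bar R} :=
  HB.pack m0 (isMeasure.Build _ _ _ m0 m00 m0ge0 m0s).
exists m => k mk k0.
pose f_ := nnsfun_approx measurableT mk.
have flim x : ((f_ n x)%:E @[n --> \oo] --> k x)%classic.
  by apply: cvg_nnsfun_approx => // y _.
have fnd x : {homo (fun n => f_ n x) : n p / (n <= p)%N >-> n <= p}.
  by move=> n p np; exact/lefP/nd_nnsfun_approx.
have f0 n x : 0 <= f_ n x by [].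
have mf n : measurable_fun setT (EFin \o f_ n) by exact/measurable_EFinP.
transitivity (limn (fun n => \int[m]_x (f_ n x)%:E))%E.
  rewrite -monotone_convergence//.
  - by apply: eq_integral => x _; apply/esym/cvg_lim => //; exact: flim.
  - by move=> n x _; rewrite lee_fin.
  - by move=> x _ n p np; rewrite lee_fin; exact: fnd.
transitivity (limn (fun n => \int[mu]_x ((f_ n x)%:E * (w x)%:E)))%E; last first.
  rewrite -monotone_convergence//.
  - apply: eq_integral => x _; apply/cvg_lim => //.
    by apply: cvgeZr => //; exact: flim.
  - by move=> n; apply: emeasurable_funM; [exact: mf|exact: mw'].
  - by move=> n x _; rewrite mule_ge0// lee_fin.
  - by move=> x _ n p np; rewrite lee_wpmul2r// lee_fin//; exact: fnd.
congr (limn _); apply/funext => n.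
have mpre r : measurable (f_ n @^-1` [set r]).
  by rewrite -[X in measurable X]setTI; exact: measurable_funP.
transitivity (\sum_(k \in range (f_ n))
    \int[m]_x (k * \1_(f_ n @^-1` [set k]) x)%:E)%E.
  under eq_integral do rewrite fimfunE -fsumEFin//.
  rewrite ge0_integral_fsum//.
  - by move=> y; exact/measurable_EFinP/measurable_funM.
  - by move=> y x _; rewrite nnfun_muleindic_ge0.
transitivity (\sum_(k \in range (f_ n))
    \int[mu]_x ((k * \1_(f_ n @^-1` [set k]) x)%:E * (w x)%:E))%E; last first.
  rewrite -ge0_integral_fsum//.
  - apply: eq_integral => x _; rewrite -ge0_mule_fsuml.
      by rewrite fsumEFin// -fimfunE.
    by move=> r; rewrite nnfun_muleindic_ge0.
  - by move=> r; apply: emeasurable_funM => //; exact/measurable_EFinP/measurable_funM.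
  - by move=> r x _; rewrite mule_ge0 ?lee_fin// -lee_fin nnfun_muleindic_ge0.
apply: eq_fsbigr => r /[!inE] -[x _ <-].
have r0 := f0 n x; set r' := f_ n x in r0 *.
under eq_integral do rewrite EFinM.
rewrite ge0_integralZl//; last exact/measurable_EFinP.
under [RHS]eq_integral do rewrite EFinM -muleA.
rewrite ge0_integralZl//; last 2 first.
  - by apply: emeasurable_funM => //; exact/measurable_EFinP.
  - by move=> ? _; rewrite mule_ge0 ?lee_fin.
congr (_ * _)%E; rewrite integral_indic// setIT /m/= /m0 integral_mkcond.
apply: eq_integral => y _; rewrite patchE /indic.
by case: ifPn => _; rewrite ?mul1e ?mul0e.
Qed.

End density.

(** Applied twice: to carry [W] L^3 to the parameter space, and to project a weighted measure from
    there onto the p-plane. *)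
Lemma density_pushforward d1 d2 (X : measurableType d1) (Y : measurableType d2)
    (R : realType) (mu : {measure set X -> \bar R}) (phi : X -> Y) (w : X -> R) :
  measurable_fun setT phi -> measurable_fun setT w -> (forall x, 0 <= w x) ->
  exists m : {measure set Y -> \bar R}, forall k : Y -> \bar R,
    measurable_fun setT k -> (forall y, 0 <= k y)%E ->
    (\int[m]_y k y = \int[mu]_x (k (phi x) * (w x)%:E))%E.
Proof.
move=> mphi mw w0.
have [m mP] := density_measure mu mw w0.
unshelve eexists (pushforward m phi) => [|k mk k0]; first exact: mphi.
rewrite (ge0_integral_pushforward mphi)//=.
rewrite preimage_setT -mP//; exact: measurableT_comp.
Qed.

(** * Test functions of one variable *)

Definition C1 (R : realType) (f : R -> R) :=
  exists2 f' : R -> R, continuous f' & forall x : R, is_derive x 1 f (f' x).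

Lemma C1_continuous (R : realType) (f : R -> R) : C1 f -> continuous f.
Proof.
by move=> [f' _ ff'] x; apply/differentiable_continuous/derivable1_diffP.
Qed.

Lemma is_derive_sqr_max0 (R : realType) (x : R) :
  is_derive x 1 (fun y : R => Num.max 0 y ^+ 2) (2 * Num.max 0 x).
Proof.
have [x0|x0|->] := ltgtP x 0.
- have e : \near x, (cst 0 : R -> R) x = Num.max 0 x ^+ 2.
    near=> y; have : y < 0 by near: y; exact: lt_nbhsl.
    by move=> y0; rewrite max_l ?ltW// expr0n.
  rewrite mulr0; exact: near_eq_is_derive e _.
- have e : \near x, (fun y : R => y ^+ 2) x = Num.max 0 x ^+ 2.
    near=> y; have : 0 < y by near: y; exact: lt_nbhsr.
    by move=> y0; rewrite max_r ?ltW.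
  apply: near_eq_is_derive e _ => //.
  have -> : (fun y : R => y ^+ 2) = (id * id : R -> R).
    by apply/funext => y; rewrite expr2.
  by apply: is_derive_eq; rewrite /GRing.scale/= !mulr1 mulr2n mulrDl !mul1r.
- rewrite mulr0.
  (* At 0 the difference quotient is at most |h| in absolute value. *)
  have cv : (fun h : R => h^-1 * (Num.max 0 (h * 1 + 0) ^+ 2 - Num.max 0 0 ^+ 2))
      @ (0 : R)^' --> (0 : R).
    apply/cvgr0Pnorm_le => e e0; near=> h.
    have h0 : h != 0 by near: h; exact: nbhs_dnbhs_neq.
    rewrite mulr1 addr0 maxxx expr0n subr0 normrM normfV.
    rewrite ler_pdivrMl ?normr_gt0// normrX expr2 mulrC ler_pM//.
      by rewrite /Num.max; case: ifPn => //; rewrite normr0.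
    apply: (@le_trans _ _ `|h|); first by rewrite /Num.max; case: ifPn => //; rewrite normr0.
    by near: h; apply: dnbhs0_le.
  split; first by apply/cvg_ex; exists 0; exact: cv.
  by apply/cvg_lim => //; exact: cv.
Unshelve. all: by end_near. Qed.

Lemma C1_comp (R : realType) (f g : R -> R) : C1 f -> C1 g -> C1 (f \o g).
Proof.
move=> cf cg; have := C1_continuous cg.
move: cf cg => [f' cf' ff'] [g' cg' gg'] cg.
exists (fun x => f' (g x) * g' x); last by move=> x; exact: is_derive1_comp.
move=> x; apply: cvgM; last exact: cg'.
by apply: continuous_comp; [exact: cg|exact: cf'].
Qed.

Lemma C1M (R : realType) (f g : R -> R) : C1 f -> C1 g -> C1 (fun x => f x * g x).
Proof.
move=> cf cg; have cgc := C1_continuous cg; have cfc := C1_continuous cf.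
move: cf cg => [f' cf' ff'] [g' cg' gg'].
exists (fun x => f x * g' x + g x * f' x); last by move=> x; exact: is_deriveM.
by move=> x; apply: cvgD; apply: cvgM; [exact: cfc|exact: cg'|exact: cgc|exact: cf'].
Qed.

(** Squares of positive parts are C^1 across the endpoints, and their product is positive exactly on
    the open interval. *)
Definition bump (R : realType) (a b x : R) : R :=
  Num.max 0 (x - a) ^+ 2 * Num.max 0 (b - x) ^+ 2.

Lemma C1_bump (R : realType) (a b : R) : C1 (bump a b).
Proof.
apply: C1M; apply: (@C1_comp _ (fun y : R => Num.max 0 y ^+ 2)).
- exists (fun x => 2 * Num.max 0 x); last exact: is_derive_sqr_max0.
  move=> x; apply: cvgM; first exact: cvg_cst.
  by apply: (@continuous_max _ _ (cst 0) id); [exact: cvg_cst|exact: cvg_id].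
- exists (cst 1) => [x|x]; first exact: cvg_cst.
  by apply: is_derive_eq; rewrite subr0.
- exists (fun x => 2 * Num.max 0 x); last exact: is_derive_sqr_max0.
  move=> x; apply: cvgM; first exact: cvg_cst.
  by apply: (@continuous_max _ _ (cst 0) id); [exact: cvg_cst|exact: cvg_id].
- exists (cst (-1)) => [x|x]; first exact: cvg_cst.
  by have := is_deriveB (is_derive_cst b x 1) (is_derive_id x 1); rewrite sub0r.
Qed.

Lemma bump_ge0 (R : realType) (a b x : R) : 0 <= bump a b x.
Proof. by rewrite mulr_ge0 ?sqr_ge0. Qed.

Lemma bump_gt0 (R : realType) (a b x : R) : (0 < bump a b x) = (a < x < b).
Proof.
apply/idP/idP => [|/andP[ax xb]].
  apply: contraTT; rewrite negb_and -!leNgt => /orP[xa|bx].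
    by rewrite /bump max_l ?subr_le0// expr0n mul0r.
  by rewrite /bump [X in _ * X ^+ 2]max_l ?subr_le0// expr0n mulr0.
by rewrite /bump !max_r ?subr_ge0 ?ltW// mulr_gt0 ?exprn_gt0 ?subr_gt0.
Qed.

Lemma bump_eq0 (R : realType) (a b x : R) : ~ (a < x < b) -> bump a b x = 0.
Proof.
move=> /negP; rewrite -bump_gt0 -leNgt => le0.
by apply/eqP; rewrite eq_le le0 bump_ge0.
Qed.

(** This is n β / (1 + n β) for β the bump of ]a, b[. It increases with n to the indicator of ]a,
    b[, so monotone convergence leads from C^1 test functions to boxes. *)
Definition cutoff (R : realType) (a b : R) (n : nat) (x : R) : R :=
  1 - (1 + n%:R * bump a b x)^-1.

Lemma cutoff_den_gt0 (R : realType) (a b : R) (n : nat) (x : R) :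
  1 <= 1 + n%:R * bump a b x.
Proof. by rewrite lerDl mulr_ge0 ?bump_ge0. Qed.

Lemma C1_cutoff (R : realType) (a b : R) (n : nat) : C1 (cutoff a b n).
Proof.
have cb := C1_continuous (C1_bump a b).
have [f' cf' ff'] := C1_bump a b.
have pos (x : R) : 1 + n%:R * bump a b x != 0.
  by rewrite gt_eqF// (lt_le_trans _ (cutoff_den_gt0 a b n x)).
have dd (x : R) : is_derive x 1 (fun x => 1 + n%:R * bump a b x) (n%:R * f' x).
  by have := is_deriveD (is_derive_cst (1 : R) x 1) (is_deriveZ n%:R (ff' x)); rewrite add0r.
exists (fun x => (1 + n%:R * bump a b x) ^- 2 * (n%:R * f' x)).
  move=> x; apply: cvgM; last first.
    by apply: cvgM; [exact: cvg_cst|exact: cf'].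
  apply: cvgV; first by rewrite expf_neq0.
  have cD : (fun y => 1 + n%:R * bump a b y) @ x --> 1 + n%:R * bump a b x.
    apply: cvgD; first exact: cvg_cst.
    by apply: cvgM; [exact: cvg_cst|exact: cb].
  exact: (cvgM cD cD).
move=> x; have := is_deriveB (is_derive_cst (1 : R) x 1) 
  (@is_deriveV _ (fun y => 1 + n%:R * bump a b y) _ _ _ (pos x) (dd x)).
by rewrite /GRing.scale/= mulNr sub0r opprK.
Qed.

Lemma cutoff_ge0 (R : realType) (a b : R) (n : nat) (x : R) : 0 <= cutoff a b n x.
Proof.
by rewrite subr_ge0 invf_le1 ?cutoff_den_gt0// (lt_le_trans _ (cutoff_den_gt0 a b n x)).
Qed.

Lemma cutoff_le1 (R : realType) (a b : R) (n : nat) (x : R) : cutoff a b n x <= 1.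
Proof.
rewrite gerBl invr_ge0 (le_trans _ (cutoff_den_gt0 a b n x))//.
Qed.

Lemma cutoff_eq0 (R : realType) (a b : R) (n : nat) (x : R) :
  ~ (a < x < b) -> cutoff a b n x = 0.
Proof. by move=> /bump_eq0; rewrite /cutoff => ->; rewrite mulr0 addr0 invr1 subrr. Qed.

Lemma cutoff_homo (R : realType) (a b x : R) :
  {homo (fun n => cutoff a b n x) : n m / (n <= m)%N >-> n <= m}.
Proof.
move=> n m nm; rewrite lerB// lef_pV2 ?posrE ?(lt_le_trans _ (cutoff_den_gt0 _ _ _ _))//.
by rewrite lerD// ler_wpM2r ?bump_ge0// ler_nat.
Qed.

Lemma cvg_cutoff (R : realType) (a b x : R) :
  cutoff a b n x @[n --> \oo] --> (\1_(`]a, b[%classic) x : R).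
Proof.
rewrite indicE; case: (boolP (a < x < b)) => [axb|/negP axb]; last first.
  rewrite memNset /= ?in_itv//=.
  by under eq_fun do rewrite cutoff_eq0//; exact: cvg_cst.
rewrite mem_set /= ?in_itv//= -[X in _ --> X]subr0.
apply: cvgB; first exact: cvg_cst.
have b0 : 0 < bump a b x by rewrite bump_gt0.
(* As n + 1 <= 2 n for n >= 1, the remainder (1 + n β)^-1 is at most (β / 2)^-1 / (n + 1), a
   multiple of the harmonic sequence. *)
apply: (@squeeze_cvgr _ _ _ _ (cst 0) (fun n => (bump a b x / 2)^-1 * n.+1%:R^-1)).
- near=> n; rewrite invr_ge0 (le_trans _ (cutoff_den_gt0 a b n x))//=.
  have n0 : (0 < n)%N by near: n; exact: nbhs_infty_gt.
  have n1 : n.+1%:R <= 2 * n%:R :> R by rewrite -natrM ler_nat mul2n -addnn -addn1 leq_add2l.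
  rewrite -invfM lef_pV2 ?posrE; last by rewrite mulr_gt0// divr_gt0.
    nra.
  exact: lt_le_trans (cutoff_den_gt0 a b n x).
- exact: cvg_cst.
- rewrite -[X in _ --> X](mulr0 (bump a b x / 2)^-1).
  by apply: cvgM; [exact: cvg_cst|exact: cvg_harmonic].
Unshelve. all: by end_near. Qed.

(** * Primitives, covers and limits of integrals *)

Lemma integrable_continuous_support (R : realType) (f : R -> R) (a b : R) :
  continuous f -> (forall x, ~ (a < x < b) -> f x = 0) ->
  (@lebesgue_measure R).-integrable setT (EFin \o f).
Proof.
move=> cf f0.
have : (@lebesgue_measure R).-integrable `[a, b] (EFin \o f).
  apply: continuous_compact_integrable; first exact: segment_compact.
  exact: continuous_subspaceT.
have mab : measurable (`[a, b]%classic : set (measurableTypeR R)) by exact: measurable_itv.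
move=> fi; 
have := (@integrable_mkcond _ (measurableTypeR R) R lebesgue_measure `[a, b] (EFin \o f) mab).1 fi.
congr (integrable _ _ _); apply/funext => x; rewrite patchE /=.
case: ifPn => // /negP; rewrite inE /= in_itv /= => xab.
by rewrite f0// => /andP[ax xb]; apply: xab; rewrite !ltW.
Qed.

(** The primitive from -oo vanishes to the left of [a] because [f] does, and to the right of [b]
    because the total integral is 0. *)
Lemma antiderivative_support (R : realType) (f : R -> R) (a b : R) :
  continuous f -> (forall x, ~ (a < x < b) -> f x = 0) ->
  (\int[lebesgue_measure]_x f x)%R = 0 ->
  exists phi : R -> R, (forall x, is_derive (x : R) 1 phi (f x)) /\
    (forall x, ~ (a < x < b) -> phi x = 0).
Proof.
move=> cf f0 intf0.
have intf := integrable_continuous_support cf f0.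
pose phi x := (\int[lebesgue_measure]_(t in [set` `]-oo, x]]) f t)%R.
exists phi; split => [x|x].
  have [dphi phi'] : derivable phi x 1 /\ phi^`()%classic x = f x.
    apply: (@continuous_FTC1 _ _ -oo%O x (x + 1)) => //; first by rewrite ltrDl.
    - exact: integrableS intf.
    - by rewrite ltNyr.
    - exact: cf.
  by apply: DeriveDef; [exact: dphi|rewrite -derive1E; exact: phi'].
move=> /negP; rewrite negb_and -!leNgt => /orP[xa|bx].
  rewrite /phi /Rintegral integral0_eq// => t; rewrite /= in_itv/= => tx.
  by rewrite f0// => /andP[at_ _]; lra.
rewrite -intf0 /phi /Rintegral integral_mkcond; congr fine.
apply: eq_integral => t _; rewrite patchE.
case: ifPn => // /negP; rewrite inE /= in_itv /= => /negP; rewrite -ltNge => xt.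
by rewrite f0// => /andP[_ tb]; lra.
Qed.

(** The closed intervals have to stay in [I], because the measures below are known to be finite on
    compact boxes only. An index whose interval leaves [I] receives (1, 0), which codes the empty
    interval; [open_plane_cover] does the same for rectangles. *)
Lemma open_line_cover (R : realType) (I : set R) : open I ->
  exists J : nat -> R * R, (forall n, `[(J n).1, (J n).2] `<=` I) /\
    I = \bigcup_n `](J n).1, (J n).2[%classic.
Proof.
move=> oI; have [ab abP] := open_itv_basis R.
pose J n := if pselect (`[(ab n).1, (ab n).2] `<=` I) then ab n else (1, 0).
have JI n : `[(J n).1, (J n).2] `<=` I.
  rewrite /J; case: pselect => // _ x /=; rewrite in_itv/= => /andP[? ?]; lra.
exists J; split => //; apply/seteqP; split => [x Ix|x [n _ xJ]]; last first.
  by apply: (JI n); exact: subset_itv_oo_cc xJ.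
have [n [xn nI]] := abP x I (open_nbhs_nbhs (conj oI Ix)).
by exists n => //; rewrite /J; case: pselect => //= _; rewrite in_itv.
Qed.

Lemma open_plane_cover (R : realType) (U : set (R * R)) : open U ->
  exists B : nat -> (R * R) * (R * R),
    (forall n, `[(B n).1.1, (B n).1.2] `*` `[(B n).2.1, (B n).2.2] `<=` U) /\
    U = \bigcup_n (`](B n).1.1, (B n).1.2[%classic `*` `](B n).2.1, (B n).2.2[%classic).
Proof.
move=> oU; have [ab abP] := open_itv_basis R.
pose C n : (R * R) * (R * R) := if unpickle n is Some (i, j) then (ab i, ab j)
  else ((1, 0), (1, 0)).
pose B n := if pselect (`[(C n).1.1, (C n).1.2] `*` `[(C n).2.1, (C n).2.2] `<=` U)
  then C n else ((1, 0), (1, 0)).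
have BU n : `[(B n).1.1, (B n).1.2] `*` `[(B n).2.1, (B n).2.2] `<=` U.
  rewrite /B; case: pselect => // _ [x y] [/= + _].
  by rewrite in_itv/= => /andP[? ?]; lra.
exists B; split => //; apply/seteqP; split => [[x y] Uxy|xy [n _ [xB yB]]]; last first.
  by apply: (BU n); split; exact: subset_itv_oo_cc.
have [[/= V1 V2] [/= xV1 yV2] VU] := open_nbhs_nbhs (conj oU Uxy).
have [i [xi iV1]] := abP _ _ xV1.
have [j [yj jV2]] := abP _ _ yV2.
exists (pickle (i, j)) => //; rewrite /B /C pickleK/=; case: pselect => /=.
  by rewrite !in_itv.
move=> ijU; exfalso; apply: ijU => -[x' y'] [/= ix jy].
by apply: VU; split; [exact: iV1|exact: jV2].
Qed.

Lemma cvg_ge0_integral d (T : measurableType d) (R : realType)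
    (mu : {measure set T -> \bar R}) (g : nat -> T -> R) (G : T -> R) :
  (forall n, measurable_fun setT (g n)) -> (forall n x, 0 <= g n x) ->
  (forall x, {homo (fun n => g n x) : n p / (n <= p)%N >-> n <= p}) ->
  (forall x, g n x @[n --> \oo] --> G x) ->
  (\int[mu]_x (g n x)%:E @[n --> \oo] --> \int[mu]_x (G x)%:E)%E.
Proof.
move=> mg g0 ng gG.
have -> : (\int[mu]_x (G x)%:E = \int[mu]_x limn (fun n => (g n x)%:E))%E.
  apply: eq_integral => x _; apply/esym/cvg_lim => //.
  exact/cvg_EFin/gG/nearW.
apply: cvg_monotone_convergence => //.
- by move=> n; exact/measurable_EFinP.
- by move=> n x _; rewrite lee_fin.
- by move=> x _ n p np; rewrite lee_fin ng.
Qed.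

(** Fubini's theorem speaks of bundled sigma-finite measures, whereas sigma-finiteness of the
    measure on the p-plane is proved after its construction. *)
Lemma sigma_finite_measure_pack d (T : measurableType d) (R : realType)
    (mu : {measure set T -> \bar R}) : sigma_finite setT mu ->
  exists nu : {sigma_finite_measure set T -> \bar R}, mu = nu :> {measure set T -> \bar R}.
Proof.
move=> mu_sf.
pose nu : {sigma_finite_measure set T -> \bar R} :=
  HB.pack (Measure.sort mu) (Measure.class mu)
    (@isSFinite.Build _ _ _ mu (sfinite_measure_sigma_finite mu_sf))
    (@isSigmaFinite.Build _ _ _ mu mu_sf).
by exists nu; exact: eq_measure.
Qed.

(** Mere continuity is asked: in the variable s, the function tested against the divergence is a
    primitive of a difference of two bumps, hence C^1. The factors in p carry [C1] as a separate
    hypothesis. *)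
Definition bump_function (R : realType) (a b : R) (f : R -> R) :=
  [/\ continuous f, forall x, 0 <= f x & forall x, ~ (a < x < b) -> f x = 0].

Lemma bump_function_cutoff (R : realType) (a b : R) n : bump_function a b (cutoff a b n).
Proof.
split => [|x|x]; [exact/C1_continuous/C1_cutoff|exact: cutoff_ge0|exact: cutoff_eq0].
Qed.

Lemma measurable_itvoo_mR (R : realType) (a b : R) :
  measurable (`]a, b[%classic : set (measurableTypeR R)).
Proof. exact: measurable_itv. Qed.

Lemma cvg_integral_cutoff (R : realType) (a b : R) :
  (\int[@lebesgue_measure R]_x (cutoff a b n x)%:E @[n --> \oo] -->
   @lebesgue_measure R `]a, b[)%E.
Proof.
have := @cvg_ge0_integral _ _ _ (@lebesgue_measure R) (cutoff a b) (\1_(`]a, b[%classic)).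
have -> : (\int[@lebesgue_measure R]_x (\1_(`]a, b[%classic) x)%:E = lebesgue_measure `]a, b[)%E.
  by rewrite integral_indic ?setIT//; exact: measurable_itvoo_mR.
apply.
- by move=> n; apply: continuous_measurable_fun; exact/C1_continuous/C1_cutoff.
- by move=> n x; exact: cutoff_ge0.
- by move=> x n p np; exact: cutoff_homo.
- by move=> x; exact: cvg_cutoff.
Qed.

Lemma bump_function_integrable (R : realType) (a b : R) eta : bump_function a b eta ->
  (@lebesgue_measure R).-integrable setT (EFin \o eta).
Proof. by move=> [ceta _ eta0]; exact: integrable_continuous_support eta0. Qed.

Lemma bump_functionZ (R : realType) (a b : R) eta (k : R) : 0 <= k -> bump_function a b eta ->
  bump_function a b (fun x => k * eta x).
Proof.
move=> k0 [ceta eta0 etas]; split => [x|x|x xab].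
- by apply: cvgM; [exact: cvg_cst|exact: ceta].
- by rewrite mulr_ge0.
- by rewrite etas// mulr0.
Qed.

Lemma bump_functionS (R : realType) (a b a' b' : R) eta : a' <= a -> b <= b' -> bump_function a b eta ->
  bump_function a' b' eta.
Proof.
move=> aa bb [ceta eta0 etas]; split => // x xab; apply: etas.
by move=> /andP[ax xb]; apply: xab; rewrite (le_lt_trans aa ax) (lt_le_trans xb bb).
Qed.

(** * Disintegration of flow invariant measures *)

Section flow_invariant_measure.
Variables (R : realType) (I : set R) (Lam : set (R * R)).
Variable m : {measure set (param R) -> \bar R}.
Hypotheses (I0 : I !=set0) (oI : open I) (iI : is_interval I) (oLam : open Lam).
Hypothesis m_fin : forall a b c d e f : R,
  `[a, b] `<=` I -> `[c, d] `*` `[e, f] `<=` Lam ->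
  (m (`[a, b] `*` (`[c, d] `*` `[e, f])) < +oo)%E.
Hypothesis m_invariant : forall (a b c d e f : R) (eta1 eta2 psi1 psi2 : R -> R),
  `[a, b] `<=` I -> `[c, d] `*` `[e, f] `<=` Lam ->
  bump_function a b eta1 -> bump_function a b eta2 ->
  C1 psi1 -> bump_function c d psi1 -> C1 psi2 -> bump_function e f psi2 ->
  (\int[lebesgue_measure]_s eta1 s = \int[lebesgue_measure]_s eta2 s)%R ->
  (\int[m]_x (eta1 x.1 * (psi1 x.2.1 * psi2 x.2.2))%:E =
   \int[m]_x (eta2 x.1 * (psi1 x.2.1 * psi2 x.2.2))%:E)%E.

Let ind (c d e f : R) (x : param R) : R :=
  \1_(`]c, d[%classic) x.2.1 * \1_(`]e, f[%classic) x.2.2.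

Lemma ind_ge0 c d e f x : 0 <= ind c d e f x.
Proof. by rewrite mulr_ge0. Qed.

Lemma indE c d e f x : ind c d e f x = \1_(`]c, d[%classic `*` `]e, f[%classic) x.2.
Proof. by rewrite /ind !indicE -natrM mulnb in_setX. Qed.

Lemma measurable_ind c d e f : measurable_fun setT (ind c d e f).
Proof.
apply: measurable_funM; apply: (@measurableT_comp _ _ _ _ (measurableTypeR R)).
- by apply: measurable_indic; exact: measurable_itvoo_mR.
- exact: (measurableT_comp measurable_fst measurable_snd).
- by apply: measurable_indic; exact: measurable_itvoo_mR.
- exact: (measurableT_comp measurable_snd measurable_snd).
Qed.

(** Monotone convergence along the cutoffs replaces the C^1 factors in p by the indicator of an open
    rectangle. *)
Lemma invariant_ind a b c d e f eta1 eta2 :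
  `[a, b] `<=` I -> `[c, d] `*` `[e, f] `<=` Lam ->
  bump_function a b eta1 -> bump_function a b eta2 ->
  (\int[lebesgue_measure]_s eta1 s = \int[lebesgue_measure]_s eta2 s)%R ->
  (\int[m]_x (eta1 x.1 * ind c d e f x)%:E =
   \int[m]_x (eta2 x.1 * ind c d e f x)%:E)%E.
Proof.
move=> abI QL b1 b2 e12.
have lim_ind eta : bump_function a b eta ->
    (\int[m]_x (eta x.1 * (cutoff c d n x.2.1 * cutoff e f n x.2.2))%:E @[n --> \oo]
     --> \int[m]_x (eta x.1 * ind c d e f x)%:E)%E.
  move=> [ceta eta0 _]; apply: cvg_ge0_integral.
  - move=> n; apply: measurable_funM; last apply: measurable_funM;
      apply: (@measurableT_comp _ _ _ _ (measurableTypeR R)).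
    + exact: continuous_measurable_fun.
    + exact: measurable_fst.
    + by apply: continuous_measurable_fun; exact/C1_continuous/C1_cutoff.
    + exact: (measurableT_comp measurable_fst measurable_snd).
    + by apply: continuous_measurable_fun; exact/C1_continuous/C1_cutoff.
    + exact: (measurableT_comp measurable_snd measurable_snd).
  - by move=> n x; rewrite mulr_ge0// mulr_ge0// cutoff_ge0.
  - by move=> x n p np; rewrite ler_wpM2l// ler_pM ?cutoff_ge0 ?cutoff_homo.
  - move=> x; apply: cvgM; first exact: cvg_cst.
    by apply: cvgM; exact: cvg_cutoff.
have l1 := lim_ind _ b1; have l2 := lim_ind _ b2.
rewrite -(cvg_lim _ l1)// -(cvg_lim _ l2)//; congr (limn _); apply/funext => n.
apply: (m_invariant abI QL b1 b2) => //; first exact: C1_cutoff.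
- exact: bump_function_cutoff.
- exact: C1_cutoff.
- exact: bump_function_cutoff.
Qed.

(** The integrals of the cutoffs of ]a, b[ tend to b - a > 0, so one of them is positive and can be
    divided out. The upper bound serves to show that the measure built from [eta] is finite on
    rectangles. *)
Lemma normalized_bump : exists a b eta, [/\ a < b, `[a, b] `<=` I, bump_function a b eta,
  (\int[lebesgue_measure]_s eta s)%R = 1 & exists C : R, forall s, eta s <= C].
Proof.
have [x Ix] := I0; have [ab abP] := open_itv_basis R.
have [n [/andP[ax xb] abI]] := abP x I (open_nbhs_nbhs (conj oI Ix)).
move: (ab n) ax xb abI => [a b]/= ax xb abI.
have a_b : a < b by exact: lt_trans xb.
pose S n := (\int[lebesgue_measure]_s cutoff a b n s)%R.
have SE p : (\int[@lebesgue_measure R]_s (cutoff a b p s)%:E = (S p)%:E)%E.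
  rewrite /S /Rintegral fineK//; apply: integrable_fin_num => //.
  exact: bump_function_integrable (bump_function_cutoff a b p).
have S0 p : 0 <= S p by apply: Rintegral_ge0 => s _; exact: cutoff_ge0.
have [p Sp] : exists p, 0 < S p.
  apply: contrapT => /forallNP SN.
  have Sz p : S p = 0 by apply/eqP; rewrite eq_le S0 leNgt andbT; exact/negP.
  have := @cvg_integral_cutoff R a b; under eq_fun do rewrite SE Sz.
  move=> /(cvg_unique _ (@cvg_cst _ _ _ _ _)) => /(_ (@ereal_hausdorff R)).
  rewrite lebesgue_measure_itv/= lte_fin a_b => /eqP; rewrite -EFinB eqe.
  by rewrite eq_sym subr_eq0 (gt_eqF a_b).
exists a, b, (fun s => (S p)^-1 * cutoff a b p s); split => //.
- by apply: bump_functionZ; [rewrite invr_ge0|exact: bump_function_cutoff].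
- rewrite RintegralZl//; last exact: bump_function_integrable (bump_function_cutoff a b p).
  by rewrite mulVf// gt_eqF.
- exists (S p)^-1 => s; rewrite ger_pMr ?invr_gt0//; exact: cutoff_le1.
Qed.

(** Two bumps with distant supports are compared inside the convex hull of both supports. It lies in
    [I] because [I] is an interval. *)
Lemma hull_sub a b a0 b0 : a < b -> a0 < b0 -> `[a, b] `<=` I -> `[a0, b0] `<=` I ->
  `[Num.min a a0, Num.max b b0] `<=` I.
Proof.
move=> ab ab0 abI abI0 x /=; rewrite in_itv/= => xh.
have ina : I a by apply: abI; rewrite /= in_itv/= lexx ltW.
have inb : I b by apply: abI; rewrite /= in_itv/= lexx ltW.
have ina0 : I a0 by apply: abI0; rewrite /= in_itv/= lexx ltW.
have inb0 : I b0 by apply: abI0; rewrite /= in_itv/= lexx ltW.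
apply: (iI _ _ xh).
  by rewrite /Num.min; case: ifPn.
by rewrite /Num.max; case: ifPn.
Qed.

Lemma measurable_bump_ind a b c d e f eta : bump_function a b eta ->
  measurable_fun setT (fun x : param R => (eta x.1 * ind c d e f x)%:E).
Proof.
move=> [ceta _ _]; apply/measurable_EFinP; apply: measurable_funM; last exact: measurable_ind.
apply: (@measurableT_comp _ _ _ _ (measurableTypeR R)); last exact: measurable_fst.
exact: continuous_measurable_fun.
Qed.

Lemma bump_ind_ge0 a b c d e f eta x : bump_function a b eta ->
  0 <= eta x.1 * ind c d e f x.
Proof. by move=> [_ eta0 _]; rewrite mulr_ge0 ?ind_ge0. Qed.

(** [eta] and its integral times [eta0] have the same integral, so invariance identifies them. The
    dependence on s is thereby split from a quantity that depends on the rectangle only. *)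
Lemma integral_bump_ind a0 b0 eta0 a b c d e f eta :
  a0 < b0 -> `[a0, b0] `<=` I -> bump_function a0 b0 eta0 ->
  (\int[lebesgue_measure]_s eta0 s)%R = 1 ->
  a < b -> `[a, b] `<=` I -> `[c, d] `*` `[e, f] `<=` Lam -> bump_function a b eta ->
  (\int[m]_x (eta x.1 * ind c d e f x)%:E =
   (\int[lebesgue_measure]_s eta s)%R%:E * \int[m]_x (eta0 x.1 * ind c d e f x)%:E)%E.
Proof.
move=> ab0 abI0 b_eta0 eta01 ab abI QL b_eta.
have S0 : 0 <= (\int[lebesgue_measure]_s eta s)%R.
  by apply: Rintegral_ge0 => s _; have [] := b_eta.
set S := Rintegral _ _ _ in S0 *.
rewrite (@invariant_ind (Num.min a a0) (Num.max b b0) _ _ _ _ _ (fun s => S * eta0 s)) //.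
- rewrite -ge0_integralZl//.
  + by apply: eq_integral => x _; rewrite -EFinM -mulrA.
  + exact: measurable_bump_ind b_eta0.
  + by move=> x _; rewrite lee_fin; exact: bump_ind_ge0 b_eta0.
- exact: hull_sub.
- by apply: bump_functionS b_eta; rewrite ?ge_min ?le_max lexx.
- apply: bump_functionZ => //.
  by apply: bump_functionS b_eta0; rewrite ?ge_min ?le_max lexx orbT.
- rewrite RintegralZl//; last exact: bump_function_integrable b_eta0.
  by rewrite eta01 mulr1.
Qed.

Lemma integral_bump_ind_lty a b c d e f eta C :
  `[a, b] `<=` I -> `[c, d] `*` `[e, f] `<=` Lam -> bump_function a b eta ->
  (forall s, eta s <= C) ->
  (\int[m]_x (eta x.1 * ind c d e f x)%:E < +oo)%E.
Proof.
move=> abI QL b_eta etaC.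
pose K : set (param R) := `[a, b]%classic `*` (`[c, d]%classic `*` `[e, f]%classic).
have mK : measurable K.
  by apply: measurableX; [exact: measurable_itv|apply: measurableX; exact: measurable_itv].
have C0 : 0 <= C by apply: le_trans (etaC 0); have [] := b_eta.
apply: (@le_lt_trans _ _ (\int[m]_x (C%:E * (\1_K x)%:E))%E).
  apply: ge0_le_integral => //.
  - by move=> x _; rewrite lee_fin; exact: bump_ind_ge0 b_eta.
  - exact: measurable_bump_ind b_eta.
  - by apply: emeasurable_funM => //; apply/measurable_EFinP; exact: measurable_indic.
  - move=> x _; rewrite -EFinM lee_fin.
    have [xK|xK] := boolP (x \in K).
      have -> : \1_K x = 1 :> R by rewrite indicE xK.
      rewrite ler_pM ?ind_ge0//; first by have [] := b_eta.
      by rewrite indE indicE lern1 leq_b1.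
    have -> : \1_K x = 0 :> R by rewrite indicE (negbTE xK).
    rewrite mulr0.
    have [xa|xa] := pselect (a < x.1 < b); last first.
      by have [_ _ ->] := b_eta; rewrite ?mul0r.
    rewrite indE indicE memNset ?mulr0// => -[xcd xef]; move/negP : xK; apply.
    rewrite inE; split; first by rewrite /= in_itv/= !ltW//; case/andP: xa.
    by split; exact: subset_itv_oo_cc.
rewrite ge0_integralZl//; last by apply/measurable_EFinP; exact: measurable_indic.
rewrite integral_indic// setIT lte_mul_pinfty ?lee_fin//; exact: m_fin.
Qed.

(** If [m] is ds x nu, then weighting it by a function of s of integral 1 and projecting to the
    p-plane gives back nu; this recipe, with [eta0], is taken as the construction of [nu]. The
    factor [\1_Lam] in the weight makes the complement of [Lam] a null set. *)
Theorem disintegration :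
  exists nu : {sigma_finite_measure set (plane R) -> \bar R},
  forall k : param R -> \bar R, measurable_fun setT k -> (forall x, 0 <= k x)%E ->
    (forall x, ~ (I `*` Lam) x -> k x = 0%E) ->
    (\int[m]_x k x = \int[nu]_p \int[lebesgue_measure]_s k (s, p))%E.
Proof.
have [a0 [b0 [eta0 [ab0 abI0 b_eta0 eta01 [C etaC]]]]] := normalized_bump.
have mLam : measurable (Lam : set (plane R)).
  exact: open_measurable_plane.
pose w (x : param R) := eta0 x.1 * \1_Lam x.2.
have mw : measurable_fun setT w.
  apply: measurable_funM; last exact: (measurableT_comp (measurable_indic mLam) measurable_snd).
  apply: (@measurableT_comp _ _ _ _ (measurableTypeR R)); last exact: measurable_fst.
  by apply: continuous_measurable_fun; have [] := b_eta0.
have w0 x : 0 <= w x by rewrite mulr_ge0//; have [] := b_eta0.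
have [nu0 nu0E] := density_pushforward m measurable_snd mw w0.
have nu0_set A : measurable A -> (nu0 A = \int[m]_x ((\1_A x.2)%:E * (w x)%:E))%E.
  move=> mA; have -> : (nu0 A = \int[nu0]_p (\1_A p)%:E)%E.
    by rewrite integral_indic// setIT.
  by apply: nu0E; [apply/measurable_EFinP; exact: measurable_indic|move=> y; rewrite lee_fin].
have mbox2 c d e f : measurable
    (`]c, d[%classic `*` `]e, f[%classic : set (plane R)).
  by apply: measurableX; exact: measurable_itvoo_mR.
have nu0_box c d e f : `[c, d] `*` `[e, f] `<=` Lam ->
    (nu0 (`]c, d[%classic `*` `]e, f[%classic) =
     \int[m]_x (eta0 x.1 * ind c d e f x)%:E)%E.
  move=> QL; rewrite nu0_set//; apply: eq_integral => x _.
  rewrite -EFinM indE mulrC /w -mulrA; congr (_ * _)%:E.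
  rewrite [in RHS]indicE; case: (boolP (_ \in _)) => [|xQ]; last first.
    by rewrite [X in _ * X]indicE (negbTE xQ) mulr0.
  rewrite inE => -[xc xe]; rewrite !indicE !mem_set ?mulr1//.
  by apply: QL; split; exact: subset_itv_oo_cc.
have [B [BL LamE]] := open_plane_cover oLam.
have [J [JI IE]] := open_line_cover oI.
have nu0_sf : sigma_finite setT nu0.
  (* Each rectangle is enlarged by the null set outside [Lam], so that the sets cover the whole
     plane and keep finite measure. *)
  exists (fun n => (`](B n).1.1, (B n).1.2[%classic `*` `](B n).2.1, (B n).2.2[%classic)
    `|` ~` Lam).
    apply/esym; rewrite -subTset => p _; have [|pL] := pselect (Lam p).
      by rewrite [X in X p]LamE => -[n _ pB]; exists n => //; left.
    by exists 0%N => //; right.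
  move=> n; split; first by apply: measurableU => //; exact: measurableC.
  have nuL : nu0 (~` Lam) = 0%E.
    rewrite nu0_set; last exact: measurableC.
    apply: integral0_eq => x _; rewrite -EFinM /w !indicE in_setC.
    by case: (x.2 \in Lam) => /=; rewrite ?(mul0r, mulr0).
  set Bn := _ `*` _; apply: (@le_lt_trans _ _ (nu0 Bn + nu0 (~` Lam))%E).
    by apply: measureU2; [exact: mbox2|exact: measurableC].
  by rewrite nuL adde0 nu0_box//; exact: (integral_bump_ind_lty abI0 (BL n) b_eta0 etaC).
have [nu nuE] := sigma_finite_measure_pack nu0_sf.
exists nu => k mk k0 kD.
have nu_box c d e f : `[c, d] `*` `[e, f] `<=` Lam ->
    (nu (`]c, d[%classic `*` `]e, f[%classic) =
     \int[m]_x (eta0 x.1 * ind c d e f x)%:E)%E.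
  move=> QL; rewrite -nu0_box//; exact: (congr1 (fun mu : {measure set (plane R) -> \bar R} => mu _) (esym nuE)).
have m_box a b c d e f : `[a, b] `<=` I -> `[c, d] `*` `[e, f] `<=` Lam ->
    m (`]a, b[%classic `*` (`]c, d[%classic `*` `]e, f[%classic)) =
    (lebesgue_measure \x nu)%E (`]a, b[%classic `*` (`]c, d[%classic `*` `]e, f[%classic)).
  move=> abI QL; have [ab|ba] := ltP a b; last first.
    by rewrite set_itv_ge ?bnd_simp -?leNgt// set0X !measure0.
  have mab := @measurable_itvoo_mR R a b; have mQ := mbox2 c d e f.
  rewrite product_measure1E// nu_box//.
  set N := (\int[m]_x (eta0 x.1 * _)%:E)%E.
  have Nfin : N \is a fin_num.
    rewrite ge0_fin_numE; first exact: (integral_bump_ind_lty abI0 QL b_eta0 etaC).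
    by apply: integral_ge0 => x _; rewrite lee_fin; exact: bump_ind_ge0 b_eta0.
  (* Both sides of the claim are limits of one sequence, obtained by putting the cutoffs of ]a, b[
     in place of its indicator: [integral_bump_ind] equates the terms. *)
  have l1 : ((\int[lebesgue_measure]_s (cutoff a b n s)%:E) * N @[n --> \oo] -->
      lebesgue_measure `]a, b[ * N)%E.
    by apply: cvgeZr => //; exact: cvg_integral_cutoff.
  have l2 : (\int[m]_x (cutoff a b n x.1 * ind c d e f x)%:E @[n --> \oo] -->
      \int[m]_x (\1_(`]a, b[%classic) x.1 * ind c d e f x)%:E)%E.
    apply: cvg_ge0_integral.
    - move=> n; apply/measurable_EFinP.
      exact: measurable_bump_ind (bump_function_cutoff a b n).
    - by move=> n x; exact: bump_ind_ge0 (bump_function_cutoff a b n).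
    - by move=> x n p np; rewrite ler_wpM2r ?ind_ge0//; exact: cutoff_homo.
    - by move=> x; apply: cvgM; [exact: cvg_cutoff|exact: cvg_cst].
  have -> : m (`]a, b[%classic `*` (`]c, d[%classic `*` `]e, f[%classic)) =
      (\int[m]_x (\1_(`]a, b[%classic) x.1 * ind c d e f x)%:E)%E.
    rewrite -(setIT (_ `*` _)) -integral_indic//; last exact: measurableX.
    by apply: eq_integral => x _; rewrite indE !indicE -natrM mulnb !in_setX.
  rewrite -(cvg_lim _ l1)// -(cvg_lim _ l2)//; congr (limn _); apply/funext => n.
  have b_cut := bump_function_cutoff a b n.
  rewrite (integral_bump_ind ab0 abI0 b_eta0 eta01 ab abI QL b_cut).
  congr (_ * _)%E; rewrite /Rintegral fineK//.
  by apply: integrable_fin_num => //; exact: bump_function_integrable b_cut.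
have m_in_D (A : set (param R)) : measurable A -> A `<=` I `*` Lam -> m A = (lebesgue_measure \x nu)%E A.
  (* Countably many boxes with closure in [I] x [Lam], each of finite [m]-measure. The intersection
     of one of them with any open box is again a box to which [m_box] applies. *)
  pose U n : set (param R) := if unpickle n is Some (i, j) then
    `](J i).1, (J i).2[%classic `*`
      (`](B j).1.1, (B j).1.2[%classic `*` `](B j).2.1, (B j).2.2[%classic) else set0.
  have mU n : measurable (U n).
    rewrite /U; case: unpickle => // -[i j].
    by apply: measurableX; [exact: measurable_itvoo_mR|exact: mbox2].
  move=> mA AD; apply: (@eq_measure_bigcup _ _ _ m (lebesgue_measure \x nu)%E U) => //; last first.
    move=> [s p] /AD[/=]; rewrite IE LamE => -[i _ si] [j _ pj].
    by exists (pickle (i, j)) => //; rewrite /U pickleK.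
  move=> n {AD mA}A mA AU.
  apply: (@eq_measure_in_box _ m (lebesgue_measure \x nu)%E (U n)) => //.
    rewrite /U; case: unpickle => [[i j]|]; last by rewrite measure0.
    apply: le_lt_trans (m_fin (@JI i) (@BL j)).
    apply: le_measure; rewrite ?inE.
    - by apply: measurableX; [exact: measurable_itvoo_mR|exact: mbox2].
    - by apply: measurableX; [exact: measurable_itv|apply: measurableX; exact: measurable_itv].
    - by move=> [s [p r]] [/= hs [hp hr]]; split; [|split]; exact: subset_itv_oo_cc.
  move=> _ [a [b [c [d [e [f ->]]]]]]; rewrite /U.
  case: unpickle => [[i j]|]; last by rewrite setI0 !measure0.
  rewrite !setXI !setI_itvoo; apply: m_box.
    apply: subset_trans (@JI i) => s; rewrite /= !in_itv/= ge_max le_min.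
    by move=> /andP[/andP[_ ->] /andP[_ ->]].
  apply: subset_trans (@BL j) => -[x y]; rewrite /= !in_itv/= !ge_max !le_min.
  by move=> [/andP[/andP[_ ->] /andP[_ ->]] /andP[/andP[_ ->] /andP[_ ->]]].
pose D : set (param R) := I `*` Lam.
have mD : measurable D.
  by apply: measurableX => //; exact: open_measurable.
(* The two measures are known to agree only inside [D], which suffices for a [k] that vanishes
   outside; Tonelli then splits the product measure. *)
have kE : k = k \_ D.
  apply/funext => x; rewrite patchE; case: ifPn => // /negP; rewrite inE.
  by move=> /kD.
rewrite [LHS](_ : _ = \int[m]_(x in D) k x)%E; last by rewrite [in LHS]kE -integral_mkcond.
rewrite (@eq_measure_integral _ _ _ D (lebesgue_measure \x nu)%E)//.
rewrite integral_mkcond -kE.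
exact: fubini_tonelli2.
Qed.

End flow_invariant_measure.

(** * Integrals of derivatives of compactly supported functions *)

Lemma is_derive_line (R : realType) (V W : normedModType R) (f : V -> W) (v a : V) (x : R) :
  derivable f (x *: v + a) v ->
  is_derive x 1 (fun y : R => f (y *: v + a)) ('D_v f (x *: v + a)).
Proof.
have e : (fun h : R => h^-1 *: (f (((h *: (1 : R) + x) : R) *: v + a) - f (x *: v + a)))
  = (fun h : R => h^-1 *: (f (h *: v + (x *: v + a)) - f (x *: v + a))).
  apply/funext => h; have -> : h *: (1 : R) = h by exact: mulr1.
  by rewrite scalerDl addrA.
move=> df; apply: DeriveDef; first by rewrite /derivable e; exact: df.
by rewrite /derive e.
Qed.

Lemma integral_derive_support (R : realType) (g g' : R -> R) (M : R) :
  (forall x : R, is_derive x 1 g (g' x)) -> continuous g' ->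
  (forall x, ~ (- M <= x <= M) -> g x = 0) ->
  (\int[@lebesgue_measure R]_x (g' x)%:E = 0)%E.
Proof.
move=> dg cg' g0.
have g'0 x : ~ (- M <= x <= M) -> g' x = 0.
  move=> xM; have -> : g' x = 'D_1 g x by rewrite derive_val.
  rewrite -(derive_cst (0 : R) x 1); apply: near_eq_derive.
  have oU : open (~` `[- M, M]%classic) by apply: closed_openC; exact: interval_closed.
  have xU : (~` `[- M, M]%classic) x by rewrite /= in_itv/=.
  by apply: filterS (open_nbhs_nbhs (conj oU xU)) => y /=; rewrite in_itv/= => /g0.
(* [N] exceeds [M] and is positive whatever the sign of [M], so the endpoints -N and N lie strictly
   outside the support. *)
pose N := `|M| + 1.
have MN : M < N by rewrite /N ltr_pwDr// ler_norm.
have NM : - N < - M by rewrite ltrN2.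
have NN : - N < N by rewrite /N; have := normr_ge0 M; lra.
have -> : (\int[@lebesgue_measure R]_x (g' x)%:E =
    \int[lebesgue_measure]_(x in `[(- N)%R, N]) (g' x)%:E)%E.
  rewrite [RHS]integral_mkcond; apply: eq_integral => x _; rewrite patchE.
  case: ifPn => // /negP; rewrite inE/= in_itv/= => xN.
  by rewrite g'0// => /andP[h1 h2]; apply: xN; apply/andP; split; lra.
rewrite (@continuous_FTC2 R g' g (- N) N NN).
- rewrite !g0 ?subee//; apply/negP; rewrite negb_and -!ltNge ?MN ?NM ?orbT//.
- exact: continuous_subspaceT.
- split => [x _||].
  + exact: ex_derive.
  + apply: cvg_at_right_filter.
    by apply/differentiable_continuous/derivable1_diffP; exact: ex_derive.
  + apply: cvg_at_left_filter.
    by apply/differentiable_continuous/derivable1_diffP; exact: ex_derive.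
- by move=> x _; rewrite derive1E derive_val.
Qed.

Lemma integrable_bounded_support d (T : measurableType d) (R : realType)
    (mu : {measure set T -> \bar R}) (f : T -> R) (K : set T) (C : R) :
  measurable K -> (mu K < +oo)%E -> measurable_fun setT f ->
  (forall x, `|f x| <= C * \1_K x) -> mu.-integrable setT (EFin \o f).
Proof.
move=> mK Koo mf fC.
apply: (@le_integrable _ _ _ mu setT _ _ (EFin \o (fun x => C * \1_K x))) => //.
- exact/measurable_EFinP.
- by move=> x _ /=; rewrite lee_fin (le_trans (fC x))// ler_norm.
- have -> : EFin \o (fun x => C * \1_K x) = (fun x => C%:E * (\1_K x)%:E)%E by [].
  apply: (@integrableZl _ _ _ mu setT measurableT C (EFin \o \1_K)).
  apply/integrableP; split; first by apply/measurable_EFinP; exact: measurable_indic.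
  under eq_integral do rewrite gee0_abs ?lee_fin//.
  by rewrite integral_indic// setIT.
Qed.

Notation heis R :=
  ((measurableTypeR R * measurableTypeR R) * measurableTypeR R)%type.

Definition heis_box (R : realType) (M : R) : set (heis R) :=
  let J := `[- M, M]%classic in (J `*` J) `*` J.

Lemma heis_box_measurable (R : realType) (M : R) : measurable (heis_box M).
Proof.
by apply: measurableX; [apply: measurableX|]; exact: measurable_itv.
Qed.

Lemma heis_box_lty (R : realType) (M : R) : (@lebesgue3 R (heis_box M) < +oo)%E.
Proof.
have mJ : measurable (`[- M, M]%classic : set (measurableTypeR R)) by exact: measurable_itv.
have mJJ := measurableX mJ mJ.
have e1 : (@lebesgue3 R (heis_box M) =
    (@lebesgue_measure R \x @lebesgue_measure R) (`[(- M)%R, M]%classic `*` `[(- M)%R, M]%classic)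
    * lebesgue_measure `[(- M)%R, M])%E by exact: (product_measure1E _ _ mJJ mJ).
have e2 : ((@lebesgue_measure R \x @lebesgue_measure R)
      (`[(- M)%R, M]%classic `*` `[(- M)%R, M]%classic)
    = lebesgue_measure `[(- M)%R, M] * lebesgue_measure `[(- M)%R, M])%E.
  exact: (product_measure1E _ _ mJ mJ).
rewrite e1 e2.
by rewrite lebesgue_measure_itv; case: ifPn => _; rewrite ?mul0e// -!EFinD -!EFinM ltry.
Qed.

Lemma compact_bound (T : topologicalType) (R : realType) (f : T -> R) (K : set T) :
  compact K -> {in K, continuous f} -> exists C : R, 0 <= C /\ forall x, K x -> `|f x| <= C.
Proof.
move=> cK cf; have [->|/set0P K0] := eqVneq K set0; first by exists 0.
have cnf : {within K, continuous (fun x => `|f x|)}.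
  apply: continuous_in_subspaceT => x xK; apply: continuous_comp; first exact: cf.
  exact: norm_continuous.
have [c Kc cmax] := compact_EVT_max K0 cK cnf.
exists `|f c|; split => // x Kx; apply: cmax; exact: mem_set.
Qed.

Lemma integrable_heis (R : realType) (f : heis R -> R) (M : R) :
  continuous (f : heisenberg R -> R) -> (forall w, ~ heis_box M w -> f w = 0) ->
  (@lebesgue3 R).-integrable setT (EFin \o f).
Proof.
move=> cf f0.
have cM : compact (heis_box M : set (heisenberg R)).
  by apply: compact_setX; [apply: compact_setX|]; exact: segment_compact.
have [C [C0 fC]] := @compact_bound _ _ f _ cM (in1W cf).
apply: (@integrable_bounded_support _ _ _ _ f (heis_box M) C).
- exact: heis_box_measurable.
- exact: heis_box_lty.
- apply: (@open_continuous_measurable_heisenberg R setT f); first exact: openT.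
  exact: in1W cf.
- move=> w; rewrite indicE; case: (boolP (_ \in _)) => [|wM].
    by rewrite inE mulr1 => /fC.
  rewrite f0 ?normr0 ?mulr0//; move=> wM'; move/negP : wM; apply; exact: mem_set.
Qed.

Lemma derive_support (R : realType) (V : normedModType R) (f : V -> R) (K : set V) (v w : V) :
  closed K -> (forall w, ~ K w -> f w = 0) -> ~ K w -> 'D_v f w = 0.
Proof.
move=> cK f0 wK; rewrite -(derive_cst (0 : R) w v); apply: near_eq_derive.
have oK := closed_openC cK.
by apply: filterS (open_nbhs_nbhs (conj oK wK)) => y /f0.
Qed.

Lemma closed_heis_box (R : realType) (M : R) : closed (heis_box M : set (heisenberg R)).
Proof.
apply: compact_closed; first exact: norm_hausdorff.
by apply: compact_setX; [apply: compact_setX|]; exact: segment_compact.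
Qed.

Lemma sigma_finite_plane (R : realType) :
  sigma_finite (setT : set (plane R)) (@lebesgue_measure R \x @lebesgue_measure R)%E.
Proof.
pose J n := `](- n%:R), n%:R[%classic : set (measurableTypeR R).
have mJ n : measurable (J n) by exact: measurable_itvoo_mR.
exists (fun n => J n `*` J n).
  apply/esym; rewrite -subTset => -[x y] _.
  have : (\bigcup_n @centered_box R n) (x, (x, y)) by rewrite centered_box_cover.
  by move=> [n _ [/= _ xyn]]; exists n.
move=> n; split; first exact: measurableX.
have Joo : (lebesgue_measure (J n) < +oo)%E.
  by rewrite /J lebesgue_measure_itv; case: ifPn => _ //; rewrite -!EFinD ltry.
have -> : (@lebesgue_measure R \x @lebesgue_measure R)%E (J n `*` J n) =
    (lebesgue_measure (J n) * lebesgue_measure (J n))%E.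
  exact: (product_measure1E (@lebesgue_measure R) (@lebesgue_measure R) (mJ n) (mJ n)).
by rewrite lte_mul_pinfty// ge0_fin_numE.
Qed.

(** The product measure bundled with its sigma-finiteness, so that Fubini can split off the
    t-coordinate. *)
Definition lebesgue_plane (R : realType) : {sigma_finite_measure set (plane R) -> \bar R} :=
  HB.pack (@lebesgue_measure R \x @lebesgue_measure R)%E
    (@isSFinite.Build _ (plane R) R _ (sfinite_measure_sigma_finite (@sigma_finite_plane R)))
    (@isSigmaFinite.Build _ (plane R) R _ (@sigma_finite_plane R)).

Lemma integral_heis_iter (R : realType) (f : heis R -> \bar R) :
  (@lebesgue3 R).-integrable setT f ->
  (\int[@lebesgue3 R]_w f w = \int[lebesgue_measure]_t \int[@lebesgue_plane R]_p f (p, t))%E /\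
  (\int[@lebesgue3 R]_w f w = \int[@lebesgue_plane R]_p \int[lebesgue_measure]_t f (p, t))%E.
Proof.
move=> intf; split.
  exact/esym/(@integral21_prod_meas1 _ _ _ _ R (lebesgue_plane R) (@lebesgue_measure R) f intf).
exact/esym/(@integral12_prod_meas1 _ _ _ _ R (lebesgue_plane R) (@lebesgue_measure R) f intf).
Qed.

Lemma integrable_plane (R : realType) (f : plane R -> R) (M : R) :
  continuous (f : R * R -> R) ->
  (forall p, ~ (`[- M, M] `*` `[- M, M])%classic p -> f p = 0) ->
  (@lebesgue_plane R).-integrable setT (EFin \o f).
Proof.
move=> cf f0; pose K : set (plane R) := `[- M, M]%classic `*` `[- M, M]%classic.
have cM : compact (K : set (R * R)) by apply: compact_setX; exact: segment_compact.
have [C [C0 fC]] := @compact_bound _ _ f _ cM (in1W cf).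
have mJ : measurable (`[- M, M]%classic : set (measurableTypeR R)) by exact: measurable_itv.
apply: (@integrable_bounded_support _ _ _ _ f K C).
- exact: measurableX.
- rewrite [X in (X < _)%E](_ : _ = (lebesgue_measure `[(- M)%R, M] * lebesgue_measure `[(- M)%R, M])%E).
    by rewrite lebesgue_measure_itv; case: ifPn => _; rewrite ?mul0e// -!EFinD -!EFinM ltry.
  exact: (product_measure1E (@lebesgue_measure R) (@lebesgue_measure R) mJ mJ).
- apply: (@open_continuous_measurable_plane R setT f); first exact: openT.
  exact: in1W cf.
- move=> w; rewrite indicE; case: (boolP (_ \in _)) => [|wM].
    by rewrite inE mulr1 => /fC.
  rewrite f0 ?normr0 ?mulr0//; move=> wM'; move/negP : wM; apply; exact: mem_set.
Qed.

Lemma integral_plane_iter (R : realType) (f : plane R -> \bar R) :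
  (@lebesgue_plane R).-integrable setT f ->
  (\int[@lebesgue_plane R]_p f p = \int[lebesgue_measure]_y \int[lebesgue_measure]_x f (x, y))%E /\
  (\int[@lebesgue_plane R]_p f p = \int[lebesgue_measure]_x \int[lebesgue_measure]_y f (x, y))%E.
Proof.
move=> intf; split.
  exact/esym/(@integral21_prod_meas1 _ _ _ _ R (@lebesgue_measure R) (@lebesgue_measure R) f intf).
exact/esym/(@integral12_prod_meas1 _ _ _ _ R (@lebesgue_measure R) (@lebesgue_measure R) f intf).
Qed.

Lemma continuous_pair (T U V : topologicalType) (f : T -> U) (g : T -> V) :
  continuous f -> continuous g -> continuous (fun x => (f x, g x)).
Proof. by move=> cf cg x; exact: (cvg_pair (cf x) (cg x)). Qed.

Lemma heis_lineE (R : realType) (k a b c x y t : R) :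
  k *: (((a, b), c) : heisenberg R) + ((x, y), t) = ((k * a + x, k * b + y), k * c + t).
Proof. by []. Qed.

Section integral_heis_derive.
Variables (R : realType) (G : heisenberg R -> R) (M : R).
Hypothesis G0 : forall w, ~ heis_box M w -> G w = 0.

Let J (x : R) : ~ (- M <= x <= M) -> ~ (`[- M, M]%classic : set R) x.
Proof. by move=> h; rewrite /= in_itv. Qed.

(** Fubini makes the integral along [v] the innermost one; on each line it is the integral of the
    derivative of a compactly supported function, hence 0. *)
Lemma integral_heis_derive (v : heisenberg R) :
  v = ((1, 0), 0) \/ v = ((0, 1), 0) \/ v = ((0, 0), 1) ->
  (forall w, derivable G w v) -> continuous (fun w => 'D_v G w) ->
  (\int[@lebesgue3 R]_w ('D_v G w)%:E = 0)%E.
Proof.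
move=> v123 dG cG.
have DG0 w : ~ heis_box M w -> 'D_v G w = 0.
  by apply: derive_support => //; exact: closed_heis_box.
have intD : (@lebesgue3 R).-integrable setT (EFin \o (fun w : heis R => 'D_v G w)).
  exact: integrable_heis DG0.
have [it ip] := integral_heis_iter intD.
have line (c : R -> heisenberg R) (a : heisenberg R) :
    (forall y, c y = y *: v + a) -> continuous c ->
    (forall y, ~ (- M <= y <= M) -> ~ heis_box M (c y)) ->
    (\int[@lebesgue_measure R]_y ('D_v G (c y))%:E = 0)%E.
  move=> cE cc cM.
  apply: (@integral_derive_support R (G \o c) (fun y => 'D_v G (c y)) M).
  - move=> y; have -> : G \o c = (fun y => G (y *: v + a)).
      by apply/funext => y' /=; rewrite cE.
    by rewrite cE; apply: is_derive_line.
  - by move=> y; exact: (continuous_comp (cc y) (cG (c y))).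
  - by move=> y yM /=; rewrite G0//; exact: cM.
have slice (t : R) : continuous (fun p : R * R => (p, t) : heisenberg R).
  by apply: (@continuous_pair _ _ _ id (cst t)) => p; [exact: cvg_id|exact: cvg_cst].
have intt t : (@lebesgue_plane R).-integrable setT (EFin \o (fun p => 'D_v G (p, t))).
  apply: (@integrable_plane _ _ M).
    by move=> p; exact: (continuous_comp (@slice t p) (cG (p, t))).
  by move=> p pM; rewrite DG0// => -[].
case: v123 => [ve|[ve|ve]].
- rewrite it; apply: integral0_eq => t _.
  have [-> _] := integral_plane_iter (intt t); apply: integral0_eq => y _.
  apply: (line (fun x => ((x, y), t)) ((0, y), t)).
  + by move=> x; rewrite ve heis_lineE !(mulr1, mulr0, addr0, add0r).
  + apply: (@continuous_pair _ _ _ (fun x => (x, y)) (cst t)); last by move=> ?; exact: cvg_cst.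
    by apply: (@continuous_pair _ _ _ id (cst y)) => ?; [exact: cvg_id|exact: cvg_cst].
  + by move=> x /J xM [[]].
- rewrite it; apply: integral0_eq => t _.
  have [_ ->] := integral_plane_iter (intt t); apply: integral0_eq => x _.
  apply: (line (fun y => ((x, y), t)) ((x, 0), t)).
  + by move=> y; rewrite ve heis_lineE !(mulr1, mulr0, addr0, add0r).
  + apply: (@continuous_pair _ _ _ (fun y => (x, y)) (cst t)); last by move=> ?; exact: cvg_cst.
    by apply: (@continuous_pair _ _ _ (cst x) id) => ?; [exact: cvg_cst|exact: cvg_id].
  + by move=> y /J yM [[]].
- rewrite ip; apply: integral0_eq => -[x y] _.
  apply: (line (fun t => ((x, y), t)) ((x, y), 0)).
  + by move=> t; rewrite ve heis_lineE !(mulr1, mulr0, addr0, add0r).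
  + by apply: (@continuous_pair _ _ _ (cst (x, y)) id) => ?; [exact: cvg_cst|exact: cvg_id].
  + by move=> t /J tM [].
Qed.

End integral_heis_derive.

(** * Functions of class C^1 *)

Section C1_calculus.
Variables (R : realType) (V : normedModType R) (D : set V).
Hypothesis oD : open D.

Lemma near_open (P : V -> Prop) x : (forall y, D y -> P y) -> D x -> \near x, P x.
Proof. by move=> DP Dx; apply: filterS (open_nbhs_nbhs (conj oD Dx)). Qed.

Lemma eq_on_continuous_for (T : topologicalType) (f g : V -> T) x :
  (forall y, D y -> f y = g y) -> D x -> {for x, continuous g} -> {for x, continuous f}.
Proof.
move=> fg Dx cg; rewrite /prop_for /continuous_at fg//.
apply: cvg_trans cg; apply: near_eq_cvg.
by apply: (near_open _ Dx) => y Dy; rewrite fg.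
Qed.

Lemma Cn1_differentiable (W : normedModType R) (f : V -> W) x :
  Cn 1 D f -> D x -> differentiable f x.
Proof. by move=> [df _]; exact: df. Qed.

Lemma Cn1_derivable (W : normedModType R) (f : V -> W) x v :
  Cn 1 D f -> D x -> derivable f x v.
Proof. by move=> cf Dx; exact/diff_derivable/(Cn1_differentiable cf). Qed.

Lemma Cn1_continuous (W : normedModType R) (f : V -> W) x :
  Cn 1 D f -> D x -> {for x, continuous f}.
Proof. by move=> cf Dx; exact/differentiable_continuous/(Cn1_differentiable cf). Qed.

Lemma Cn1_derive_continuous (W : normedModType R) (f : V -> W) x v :
  Cn 1 D f -> D x -> {for x, continuous (fun y => 'D_v f y)}.
Proof. by move=> [_ cDf]; exact: cDf. Qed.

(** The formula [df] for the derivative holds on [D] only. As [D] is open, its continuity still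
    passes to ['D_v f] at the points of [D]. *)
Lemma Cn1_intro (W : normedModType R) (f : V -> W) (df : V -> V -> W) :
  (forall x, D x -> differentiable f x) ->
  (forall x v, D x -> 'D_v f x = df v x) ->
  (forall x v, D x -> {for x, continuous (df v)}) -> Cn 1 D f.
Proof.
move=> diff_f dfE cdf; split => // v x Dx.
by apply: (eq_on_continuous_for _ Dx) (cdf x v Dx) => y Dy; exact: dfE.
Qed.

Lemma derive_comp_linear (U W : normedModType R) (L : {linear U -> W}) (f : V -> U) x v :
  continuous L -> differentiable f x -> 'D_v (L \o f) x = L ('D_v f x).
Proof.
move=> cL df; have dL := linear_differentiable (f x) cL.
rewrite (deriveE _ (differentiable_comp df dL)) (deriveE _ df).
rewrite (diff_comp df dL).
by rewrite [LHS]/= (diff_lin _ cL).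
Qed.

Lemma Cn1_comp_linear (U W : normedModType R) (L : {linear U -> W}) (f : V -> U) :
  continuous L -> Cn 1 D f -> Cn 1 D (L \o f).
Proof.
move=> cL cf; apply: (@Cn1_intro _ _ (fun v x => L ('D_v f x))) => x.
- move=> Dx; apply: differentiable_comp; first exact: Cn1_differentiable cf Dx.
  exact: linear_differentiable.
- by move=> v Dx; apply: derive_comp_linear => //; exact: Cn1_differentiable cf Dx.
- move=> v Dx; exact: (continuous_comp (Cn1_derive_continuous cf Dx) (cL _)).
Qed.

Lemma Cn1M (f g : V -> R) : Cn 1 D f -> Cn 1 D g -> Cn 1 D (fun x => f x * g x).
Proof.
move=> cf cg.
apply: (@Cn1_intro _ _ (fun v x => f x * 'D_v g x + g x * 'D_v f x)) => x.
- by move=> Dx; apply: differentiableM; [exact: Cn1_differentiable cf Dx|exact: Cn1_differentiable cg Dx].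
- by move=> v Dx; rewrite deriveM//; [exact: Cn1_derivable cf Dx|exact: Cn1_derivable cg Dx].
- move=> v Dx.
  have := Cn1_continuous cf Dx; have := Cn1_continuous cg Dx.
  have := @Cn1_derive_continuous _ f x v cf Dx; have := @Cn1_derive_continuous _ g x v cg Dx.
  by move=> c1 c2 c3 c4; apply: cvgD; apply: cvgM.
Qed.

Lemma Cn1D (f g : V -> R) : Cn 1 D f -> Cn 1 D g -> Cn 1 D (fun x => f x + g x).
Proof.
move=> cf cg.
apply: (@Cn1_intro _ _ (fun v x => 'D_v f x + 'D_v g x)) => x.
- by move=> Dx; apply: differentiableD; [exact: Cn1_differentiable cf Dx|exact: Cn1_differentiable cg Dx].
- by move=> v Dx; rewrite deriveD//; [exact: Cn1_derivable cf Dx|exact: Cn1_derivable cg Dx].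
- move=> v Dx.
  by apply: cvgD; [exact: Cn1_derive_continuous cf Dx|exact: Cn1_derive_continuous cg Dx].
Qed.

Lemma Cn1_cst (c : R) : Cn 1 D (fun=> c).
Proof.
apply: (@Cn1_intro _ _ (fun v x => 0)) => x.
- by move=> _; exact: differentiable_cst.
- by move=> v _; exact: derive_cst.
- by move=> v _; exact: cvg_cst.
Qed.

(** Restriction to the line through [x] in direction [v] reduces this to the one-variable chain
    rule, so derivability of [f] in that single direction suffices. *)
Lemma derive_comp_real (h : R -> R) (a : R) (f : V -> R) x v :
  is_derive (f x) 1 h a -> derivable f x v -> 'D_v (h \o f) x = a * 'D_v f x.
Proof.
move=> dh df.
have line (g : V -> R) : (fun t : R => t^-1 *: (g (t *: v + x) - g x)) =
    (fun t : R => t^-1 *: ((fun y : R => g (y *: v + x)) (t *: (1 : R) + 0) -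
      (fun y : R => g (y *: v + x)) 0)).
  apply/funext => t /=; rewrite scale0r add0r addr0.
  by have -> : t *: (1 : R) = t by exact: mulr1.
have dline : is_derive (0 : R) 1 (fun y : R => f (y *: v + x)) ('D_v f x).
  by apply: DeriveDef; [rewrite /derivable -line; exact: df|rewrite /derive -line].
rewrite [LHS]/derive line -/(derive _ _ _).
have dh' : is_derive (f (0 *: v + x)) 1 h a by rewrite scale0r add0r.
by have := is_derive1_comp dh' dline => -[_ <-].
Qed.

Lemma Cn1_comp_real (h h' : R -> R) (f : V -> R) :
  (forall x, D x -> is_derive (f x) 1 h (h' (f x))) ->
  (forall x, D x -> {for f x, continuous h'}) ->
  Cn 1 D f -> Cn 1 D (h \o f).
Proof.
move=> dh ch' cf; apply: (@Cn1_intro _ _ (fun v x => h' (f x) * 'D_v f x)) => x.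
- move=> Dx; apply: differentiable_comp; first exact: Cn1_differentiable cf Dx.
  by apply/derivable1_diffP; have [] := dh x Dx.
- by move=> v Dx; apply: derive_comp_real; [exact: dh|exact: Cn1_derivable cf Dx].
- move=> v Dx; apply: cvgM; last exact: Cn1_derive_continuous cf Dx.
  exact: (continuous_comp (Cn1_continuous cf Dx) (ch' x Dx)).
Qed.

End C1_calculus.

Lemma continuous_fst (T U : topologicalType) : continuous (fst : T * U -> T).
Proof. by move=> x; exact: cvg_fst. Qed.

Lemma continuous_snd (T U : topologicalType) : continuous (snd : T * U -> U).
Proof. by move=> x; exact: cvg_snd. Qed.

Section pair_calculus.
Variables (R : realType) (V : normedModType R) (D : set V).
Variables (U W : normedModType R) (f : V -> U * W).
Hypothesis oD : open D.

Let fst_linear : {linear (U * W)%type -> U} :=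
  HB.pack (fst : U * W -> U) (GRing.isLinear.Build R (U * W)%type U *:%R fst (fun a x y => erefl)).

Let snd_linear : {linear (U * W)%type -> W} :=
  HB.pack (snd : U * W -> W) (GRing.isLinear.Build R (U * W)%type W *:%R snd (fun a x y => erefl)).

Lemma differentiable_fst_comp x : differentiable f x -> differentiable (fun y => (f y).1) x.
Proof.
move=> df; apply: (@differentiable_comp _ _ _ _ f fst_linear) => //.
by apply: linear_differentiable; exact: continuous_fst.
Qed.

Lemma derive_fst x v : differentiable f x -> 'D_v (fun y => (f y).1) x = ('D_v f x).1.
Proof.
by move=> df; apply: (@derive_comp_linear _ _ _ _ fst_linear) => //; exact: continuous_fst.
Qed.

Lemma derive_snd x v : differentiable f x -> 'D_v (fun y => (f y).2) x = ('D_v f x).2.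
Proof.
by move=> df; apply: (@derive_comp_linear _ _ _ _ snd_linear) => //; exact: continuous_snd.
Qed.

Lemma Cn1_fst : Cn 1 D f -> Cn 1 D (fun y => (f y).1).
Proof. by apply: (@Cn1_comp_linear _ _ _ oD _ _ fst_linear); exact: continuous_fst. Qed.

Lemma Cn1_snd : Cn 1 D f -> Cn 1 D (fun y => (f y).2).
Proof. by apply: (@Cn1_comp_linear _ _ _ oD _ _ snd_linear); exact: continuous_snd. Qed.

End pair_calculus.

Lemma derive_decompose (R : realType) (k : R * (R * R) -> R) (x v : R * (R * R)) :
  differentiable k x ->
  'D_v k x = v.1 * 'D_((1, (0, 0))) k x + v.2.1 * 'D_((0, (1, 0))) k x
    + v.2.2 * 'D_((0, (0, 1))) k x.
Proof.
move=> dk; rewrite !(deriveE _ dk).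
have -> : v = v.1 *: ((1, (0, 0)) : R * (R * R)) + v.2.1 *: ((0, (1, 0)) : R * (R * R))
    + v.2.2 *: ((0, (0, 1)) : R * (R * R)).
  case: v => a [b c] /=.
  transitivity ((a * 1 + b * 0 + c * 0, (a * 0 + b * 1 + c * 0, a * 0 + b * 0 + c * 1)) : R * (R * R)).
    by rewrite !(mulr1, mulr0, addr0, add0r).
  by [].
rewrite !linearD !linearZ /=.
by rewrite /GRing.scale/= !(mulr1, mulr0, addr0, add0r).
Qed.

Lemma derive_comp_param (R : realType) (V : normedModType R) (k : R * (R * R) -> R)
    (f : V -> R * (R * R)) x v :
  differentiable f x -> differentiable k (f x) ->
  'D_v (k \o f) x = 'D_('D_v f x) k (f x).
Proof.
move=> df dk.
rewrite (deriveE _ (differentiable_comp df dk)) (diff_comp df dk).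
by rewrite (deriveE _ dk) (deriveE _ df).
Qed.

(** [Cn] provides continuity of ['D_u k] for a fixed direction u, but the chain rule produces the
    moving direction ['D_v f x]. Expanding it in the standard basis separates the direction from the
    point. *)
Lemma Cn1_comp_param (R : realType) (V : normedModType R) (D : set V)
    (E : set (R * (R * R))) (k : R * (R * R) -> R) (f : V -> R * (R * R)) :
  open D -> Cn 1 E k -> Cn 1 D f -> (forall x, D x -> E (f x)) -> Cn 1 D (k \o f).
Proof.
move=> oD ck cf fE; pose df v x := 'D_v f x.
apply: (@Cn1_intro _ _ _ oD _ _ (fun v x => (df v x).1 * 'D_((1, (0, 0))) k (f x) +
  (df v x).2.1 * 'D_((0, (1, 0))) k (f x) + (df v x).2.2 * 'D_((0, (0, 1))) k (f x))) => x.
- move=> Dx; apply: differentiable_comp; first exact: (Cn1_differentiable cf Dx).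
  exact: (Cn1_differentiable ck (fE x Dx)).
- move=> v Dx; have dk := Cn1_differentiable ck (fE x Dx).
  by rewrite (derive_comp_param _ (Cn1_differentiable cf Dx) dk) (derive_decompose _ dk).
- move=> v Dx.
  have cd u : {for x, continuous (fun y => 'D_u k (f y))}.
    exact: (continuous_comp (Cn1_continuous cf Dx)
      (@Cn1_derive_continuous _ _ E _ k (f x) u ck (fE x Dx))).
  have cdf : {for x, continuous (df v)} by exact: (@Cn1_derive_continuous _ _ D _ f x v cf Dx).
  have cdf1 := continuous_comp cdf (@continuous_fst _ _ (df v x)).
  have cdf2 := continuous_comp cdf (@continuous_snd _ _ (df v x)).
  have cdf21 := continuous_comp cdf2 (@continuous_fst _ _ (df v x).2).
  have cdf22 := continuous_comp cdf2 (@continuous_snd _ _ (df v x).2).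
  by apply: cvgD; [apply: cvgD|]; apply: cvgM => //; exact: cd.
Qed.

(** * Extension by zero *)

Section extension_by_zero.
Variables (R : realType) (V : normedModType R) (D K : set V) (h : V -> R).
Hypotheses (oD : open D) (cK : closed K) (KD : K `<=` D).

Lemma patch_near_in x : D x -> \near x, h x = (h \_ D) x.
Proof. by move=> Dx; apply: (near_open oD _ Dx) => y Dy; rewrite patchE mem_set. Qed.

Hypothesis h0 : forall x, D x -> ~ K x -> h x = 0.

Lemma patch_eq0 x : ~ K x -> (h \_ D) x = 0.
Proof. by move=> Kx; rewrite patchE; case: ifPn => //; rewrite inE => Dx; exact: h0. Qed.

Lemma patch_near_out x : ~ K x -> \near x, cst 0 x = (h \_ D) x.
Proof.
move=> Kx; apply: (near_open (closed_openC cK) _ Kx) => y Ky.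
by rewrite patch_eq0.
Qed.

(** The open sets [D] and the complement of [K] cover the space; near a point of the first the
    extension is [h], near a point of the second it is 0. The lemmas on derivatives rest on the same
    dichotomy. *)
Lemma patch_continuous : {in D, continuous h} -> continuous (h \_ D).
Proof.
move=> ch x; have [Dx|Dx] := pselect (D x).
  have cx : {for x, continuous h} by apply: ch; rewrite inE.
  have hx : (h \_ D) x = h x by rewrite patchE mem_set.
  rewrite /continuous_at hx; apply: cvg_trans cx; apply: near_eq_cvg.
  by apply: filterS (patch_near_in Dx).
have Kx : ~ K x by move=> /KD.
rewrite /continuous_at (patch_eq0 Kx); apply: cvg_trans (@cvg_cst _ (0 : R) V (nbhs x) _).
apply: near_eq_cvg.
by apply: filterS (patch_near_out Kx).
Qed.

Lemma patch_derivable v : (forall x, D x -> derivable h x v) ->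
  forall x, derivable (h \_ D) x v.
Proof.
move=> dh x; have [Dx|Dx] := pselect (D x).
  exact: (near_eq_derivable (patch_near_in Dx) (dh x Dx)).
have Kx : ~ K x by move=> /KD.
exact: (near_eq_derivable (patch_near_out Kx) (derivable_cst 0 x v)).
Qed.

Lemma patch_derive v : 'D_v (h \_ D) = (fun x => 'D_v h x) \_ D.
Proof.
apply/funext => x; rewrite [RHS]patchE; case: ifPn => [|/negP]; rewrite inE => Dx.
  by rewrite -(near_eq_derive v (patch_near_in Dx)).
have Kx : ~ K x by move=> /KD.
by rewrite -(near_eq_derive v (patch_near_out Kx)) derive_cst.
Qed.

End extension_by_zero.

Local Open Scope complex_scope.

(** * Divergence free fields from quadratic differentials *)

(* XA, YA, ... stand for the derivatives along X and Y of A, ..., where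
   Z = (X - i Y) / 2. The hypotheses are the X- and Y-derivatives of
   (A + i B)^2 = N (c - i d) and twice the two parts of B_2 (c + i d) = 0. *)
Lemma null_divergence_algebra (R : realType) (A B XA XB YA YB c d Xc Xd Yc Yd : R) :
  0 < A ^+ 2 + B ^+ 2 ->
  let N := c ^+ 2 + d ^+ 2 in
  let XN := 2 * c * Xc + 2 * d * Xd in let YN := 2 * c * Yc + 2 * d * Yd in
  2 * A * XA - 2 * B * XB = XN * c + N * Xc ->
  2 * A * YA - 2 * B * YB = YN * c + N * Yc ->
  2 * (A * XB + B * XA) = - (XN * d + N * Xd) ->
  2 * (A * YB + B * YA) = - (YN * d + N * Yd) ->
  XN + c * (Xc - Yd) + d * (Xd + Yc) = 0 ->
  YN + c * (Xd + Yc) - d * (Xc - Yd) = 0 ->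
  XA + YB = 0.
Proof.
move=> AB0 N XN YN e1 e2 e3 e4 r1 r2.
(* [h1] and [h2] are the two parts of (X - iY)((A + iB)^2) = 2 (A + iB) (X - iY)(A + iB). With q = c
   + i d this is the conjugate of (X + iY)(|q|^2 q) = 2 q B_2 q, which is 0. *)
have h1 : 2 * (A * (XA + YB) - B * (XB - YA)) = 0.
  transitivity ((XN * c + N * Xc) - (YN * d + N * Yd)).
    by rewrite -e1 -[in RHS](opprK (YN * d + _)) -e4; ring.
  transitivity (c * (XN + c * (Xc - Yd) + d * (Xd + Yc)) - d * (YN + c * (Xd + Yc) - d * (Xc - Yd))).
    by rewrite /N; ring.
  by rewrite r1 r2; ring.
have h2 : 2 * (B * (XA + YB) + A * (XB - YA)) = 0.
  transitivity (- (XN * d + N * Xd) - (YN * c + N * Yc)).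
    by rewrite -e3 -e2; ring.
  transitivity (- (d * (XN + c * (Xc - Yd) + d * (Xd + Yc)) + c * (YN + c * (Xd + Yc) - d * (Xc - Yd)))).
    by rewrite /N; ring.
  by rewrite r1 r2; ring.
(* Multiplication by A - iB and passage to the real part isolate XA + YB. *)
have : (A ^+ 2 + B ^+ 2) * (XA + YB) = 0.
  transitivity (A * (2 * (A * (XA + YB) - B * (XB - YA))) / 2 + B * (2 * (B * (XA + YB) + A * (XB - YA))) / 2).
    by field.
  by rewrite h1 h2; ring.
by move/eqP; rewrite mulf_eq0 gt_eqF//= => /eqP.
Qed.

(** Substitution of X = d/dx + 2 y d/dt and Y = d/dy - 2 x d/dt in the preceding identity; each
    hypothesis on an X- or Y-derivative is a combination of those on coordinate derivatives. *)
Lemma divergence_algebra (R : realType)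
    (A B c d x y Ax Ay At Bx By Bt cx cy ct dx dy dt : R) :
  0 < A ^+ 2 + B ^+ 2 ->
  let N := c ^+ 2 + d ^+ 2 in
  let Nx := 2 * c * cx + 2 * d * dx in let Ny := 2 * c * cy + 2 * d * dy in
  let Nt := 2 * c * ct + 2 * d * dt in
  2 * A * Ax - 2 * B * Bx = Nx * c + N * cx ->
  2 * A * Ay - 2 * B * By = Ny * c + N * cy ->
  2 * A * At - 2 * B * Bt = Nt * c + N * ct ->
  2 * (A * Bx + B * Ax) = - (Nx * d + N * dx) ->
  2 * (A * By + B * Ay) = - (Ny * d + N * dy) ->
  2 * (A * Bt + B * At) = - (Nt * d + N * dt) ->
  (Nx + 2 * y * Nt) + c * ((cx + 2 * y * ct) - (dy - 2 * x * dt)) +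
    d * ((dx + 2 * y * dt) + (cy - 2 * x * ct)) = 0 ->
  (Ny - 2 * x * Nt) + c * ((dx + 2 * y * dt) + (cy - 2 * x * ct)) -
    d * ((cx + 2 * y * ct) - (dy - 2 * x * dt)) = 0 ->
  (Ax + 2 * y * At) + (By - 2 * x * Bt) = 0.
Proof.
move=> AB0 N Nx Ny Nt rx ry rt ix iy it r1 r2.
apply: (@null_divergence_algebra _ A B _ (Bx + 2 * y * Bt) (Ay - 2 * x * At) _ c d
  (cx + 2 * y * ct) (dx + 2 * y * dt) (cy - 2 * x * ct) (dy - 2 * x * dt)) => //.
- transitivity ((2 * A * Ax - 2 * B * Bx) + 2 * y * (2 * A * At - 2 * B * Bt)); first by ring.
  by rewrite rx rt /N /Nx /Nt; ring.
- transitivity ((2 * A * Ay - 2 * B * By) - 2 * x * (2 * A * At - 2 * B * Bt)); first by ring.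
  by rewrite ry rt /N /Ny /Nt; ring.
- transitivity (2 * (A * Bx + B * Ax) + 2 * y * (2 * (A * Bt + B * At))); first by ring.
  by rewrite ix it /N /Nx /Nt; ring.
- transitivity (2 * (A * By + B * Ay) - 2 * x * (2 * (A * Bt + B * At))); first by ring.
  by rewrite iy it /N /Ny /Nt; ring.
- by rewrite -[RHS]r1 /Nx /Nt; ring.
- by rewrite -[RHS]r2 /Ny /Nt; ring.
Qed.

(** With q = c + i d and u = u1 + i u2 the hypotheses read q u^2 = r > 0. Taking moduli gives r =
    N^(1/2) U, hence W^2 = N^2 / r; multiplying by conj q gives N u^2 = r conj q. Together, (W u)^2
    = N conj q. *)
Lemma unit_field_algebra (R : realType) (c d u1 u2 : R) :
  let N := c ^+ 2 + d ^+ 2 in let U := u1 ^+ 2 + u2 ^+ 2 in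
  let W := N / (Num.sqrt (Num.sqrt N) * Num.sqrt U) in
  0 < c * (u1 ^+ 2 - u2 ^+ 2) - d * (2 * u1 * u2) ->
  c * (2 * u1 * u2) + d * (u1 ^+ 2 - u2 ^+ 2) = 0 ->
  [/\ 0 < N, 0 < U, (W * u1) ^+ 2 - (W * u2) ^+ 2 = N * c &
    2 * ((W * u1) * (W * u2)) = - (N * d)].
Proof.
move=> N U W; set P := u1 ^+ 2 - u2 ^+ 2; set S := 2 * u1 * u2; set r := c * P - d * S.
move=> r0 e0.
have N0 : 0 < N.
  rewrite lt_neqAle addr_ge0 ?sqr_ge0// andbT eq_sym; apply/eqP => N0.
  have : (c == 0) && (d == 0) by rewrite -(sqrf_eq0 c) -(sqrf_eq0 d) -paddr_eq0 ?sqr_ge0//; apply/eqP.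
  by move=> /andP[/eqP c0 /eqP d0]; move: r0; rewrite /r c0 d0 !mul0r subr0 ltxx.
have U0 : 0 < U.
  rewrite lt_neqAle addr_ge0 ?sqr_ge0// andbT eq_sym; apply/eqP => U0.
  have : (u1 == 0) && (u2 == 0) by rewrite -(sqrf_eq0 u1) -(sqrf_eq0 u2) -paddr_eq0 ?sqr_ge0//; apply/eqP.
  by move=> /andP[/eqP c0 /eqP d0]; move: r0; rewrite /r /P /S c0 d0 !(mulr0, expr0n, subr0) ltxx.
have sN0 : 0 < Num.sqrt N by rewrite sqrtr_gt0.
have sN : Num.sqrt N ^+ 2 = N by rewrite sqr_sqrtr// ltW.
have ssN : Num.sqrt (Num.sqrt N) ^+ 2 = Num.sqrt N by rewrite sqr_sqrtr// ltW.
have sU : Num.sqrt U ^+ 2 = U by rewrite sqr_sqrtr// ltW.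
have rE : r = Num.sqrt N * U.
  apply/eqP; rewrite -(@eqrXn2 _ 2)//; [|exact: ltW|by rewrite mulr_ge0// ltW].
  rewrite exprMn sN; apply/eqP.
  transitivity (r ^+ 2 + (c * S + d * P) ^+ 2); first by rewrite e0 expr0n addr0.
  by rewrite /r /N /U /P /S; ring.
have W2 : W ^+ 2 = N ^+ 2 / r.
  by rewrite /W rE expr_div_n exprMn ssN sU.
have NP : N * P = c * r.
  transitivity (c * r + d * (c * S + d * P)); first by rewrite /N /r; ring.
  by rewrite e0 mulr0 addr0.
have NS : N * S = - (d * r).
  transitivity (c * (c * S + d * P) - d * r); first by rewrite /N /r; ring.
  by rewrite e0 mulr0 add0r.
have r_neq0 : r != 0 by rewrite gt_eqF.
split => //.
- transitivity (W ^+ 2 * P); first by rewrite /P; ring.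
  rewrite W2; transitivity (N * (N * P) / r); first by field.
  by rewrite NP; field.
- transitivity (W ^+ 2 * S); first by rewrite /S; ring.
  rewrite W2; transitivity (N * (N * S) / r); first by field.
  by rewrite NS; field.
Qed.

Lemma complex_B2_algebra (R : realType) (c d Nx Ny Nt cx cy ct dx dy dt x y : R) :
  ((Nx +i* 0) + 'i * (Ny +i* 0)) / 2%:R - 'i * (x +i* y) * (Nt +i* 0) +
  (c +i* d)^* * (((cx +i* dx) + 'i * (cy +i* dy)) / 2%:R - 'i * (x +i* y) * (ct +i* dt)) = 0 ->
  let XN := Nx + 2 * y * Nt in let YN := Ny - 2 * x * Nt in
  let Xc := cx + 2 * y * ct in let Yc := cy - 2 * x * ct in
  let Xd := dx + 2 * y * dt in let Yd := dy - 2 * x * dt in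
  XN + c * (Xc - Yd) + d * (Xd + Yc) = 0 /\
  YN + c * (Xd + Yc) - d * (Xc - Yd) = 0.
Proof.
have -> : (2%:R : R[i])^-1 = (2^-1)%:C by rewrite fmorphV rmorph_nat.
move=> + XN YN Xc Yc Xd Yd; simpc => /eqP; rewrite eq_complex /= => /andP[/eqP re /eqP im].
split.
  by rewrite -[RHS](mulr0 2) -re /XN /Xc /Yc /Xd /Yd; field.
by rewrite -[RHS](mulr0 2) -im /YN /Xc /Yc /Xd /Yd; field.
Qed.

Lemma normCK_re_im (R : realType) (z : R[i]) :
  `|z| ^+ 2 = (complex.Re z ^+ 2 + complex.Im z ^+ 2) +i* 0.
Proof. by rewrite sqr_normc; case: z => a b; simpc; rewrite !expr2; congr (_ +i* _); ring. Qed.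

(** The convex function r^4 lies above its tangent at r = c. For r = +oo the right-hand side is
    infinite. *)
Lemma young4 (R : realType) (c : R) (r : \bar R) : 0 <= c -> (0 <= r)%E ->
  ((4 * c ^+ 3)%:E * r <= r ^+ 4 + (3 * c ^+ 4)%:E)%E.
Proof.
move=> c0; case: r => [r| |] // r0.
  rewrite -EFin_expe -EFinM -EFinD lee_fin -subr_ge0.
  have -> : r ^+ 4 + 3 * c ^+ 4 - 4 * c ^+ 3 * r = (r - c) ^+ 2 * ((r + c) ^+ 2 + 2 * c ^+ 2).
    by ring.
  apply: mulr_ge0; first exact: sqr_ge0.
  by apply: addr_ge0; [exact: sqr_ge0|apply: mulr_ge0 => //; exact: sqr_ge0].
have -> : ((+oo : \bar R) ^+ 4 = +oo)%E by rewrite !expeS expe0 mule1 !mulyy.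
by rewrite addye// leey.
Qed.

(** * The modulus of a family of trajectories *)

Section trajectories.
Variables (R : realType) (I : set R) (Lam : set (R * R)).
Variables (Om : set (heisenberg R)) (Phi : R * (R * R) -> heisenberg R).
Variable q : heisenberg R -> R[i].
Hypotheses (I0 : I !=set0) (oI : open I) (iI : is_interval I) (oLam : open Lam).
Hypothesis oOm : open Om.
Hypothesis hPhi : Cn_diffeomorphism 2 (I `*` Lam) Om Phi.
Hypothesis hq : smoothC Om q.
Hypothesis hB2 : forall w, Om w -> B2 q w = 0.
Hypothesis hhor : forall J gamma, curve_family I Lam Phi (J, gamma) ->
  horizontal_trajectory Om q J gamma.

Let D : set (R * (R * R)) := I `*` Lam.
Let Psi : heisenberg R -> R * (R * R) := pinv D Phi.
Let e1 : R * (R * R) := (1, (0, 0)).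

Lemma open_D : open D.
Proof.
rewrite openE => -[s p] [/= Is Lp]; exists (I, Lam) => //=.
by split; exact: open_nbhs_nbhs.
Qed.

Lemma Cn2_Cn1 (V W : normedModType R) (E : set V) (f : V -> W) : Cn 2 E f -> Cn 1 E f.
Proof.
move=> [df cDf]; split => // v x Ex.
by apply: differentiable_continuous; have [h _] := cDf v; exact: h.
Qed.

Lemma Phi_Cn1 : Cn 1 D Phi.
Proof. by have [_ h _] := hPhi; exact: Cn2_Cn1. Qed.

Lemma Psi_Cn1 : Cn 1 Om Psi.
Proof. by have [_ _ h] := hPhi; exact: Cn2_Cn1. Qed.

Lemma Phi_Om x : D x -> Om (Phi x).
Proof. by have [[h _ _] _ _] := hPhi; exact: h. Qed.

Lemma PhiK x : D x -> Psi (Phi x) = x.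
Proof.
have [[_ inj _] _ _] := hPhi => Dx.
by apply: (@pinvKV _ _ _ D Phi inj); rewrite inE.
Qed.

Lemma Psi_D w : Om w -> D (Psi w).
Proof.
have [[_ _ surj] _ _] := hPhi => /surj[x Dx <-].
by rewrite PhiK.
Qed.

Lemma PsiK w : Om w -> Phi (Psi w) = w.
Proof.
have [[_ _ surj] _ _] := hPhi => /surj[x Dx <-].
by rewrite PhiK.
Qed.

Definition tangent (w : heisenberg R) : heisenberg R := 'D_e1 Phi (Psi w).

Lemma derive1_curve s p : D (s, p) ->
  is_derive s 1 (fun s => Phi (s, p)) ('D_e1 Phi (s, p)).
Proof.
move=> Dsp; pose a : R * (R * R) := (0, p).
have lineE (y : R) : y *: e1 + a = (y, p).
  case: p @a {Dsp} => p1 p2 /=.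
  transitivity ((y * 1 + 0, (y * 0 + p1, y * 0 + p2)) : R * (R * R)); first by [].
  by rewrite !(mulr1, mulr0, addr0, add0r).
have := @is_derive_line R _ _ Phi e1 a s; rewrite lineE.
under eq_fun do rewrite lineE.
by apply; exact: (Cn1_derivable Phi_Cn1).
Qed.

Lemma derive1_curveE s p : D (s, p) ->
  derive1 (fun s => Phi (s, p)) s = tangent (Phi (s, p)).
Proof.
move=> Dsp; transitivity ('D_1 (fun s => Phi (s, p)) s); first exact: derive1E.
rewrite /tangent (PhiK Dsp).
by have [_ ->] := derive1_curve Dsp.
Qed.

Lemma zvelocity_curve s p : D (s, p) ->
  zvelocity (fun s => Phi (s, p)) s = zcoord (tangent (Phi (s, p))).
Proof. by move=> Dsp; rewrite /zvelocity (derive1_curveE Dsp). Qed.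

Lemma curve_horizontal p : Lam p -> horizontal_trajectory Om q I (fun s => Phi (s, p)).
Proof. by move=> Lp; apply: hhor; exists p. Qed.

(** * The weighted tangent field and its divergence *)

Let u1 w := (tangent w).1.1.
Let u2 w := (tangent w).1.2.
Let q1 w : R := complex.Re (q w).
Let q2 w : R := complex.Im (q w).
Let N w := q1 w ^+ 2 + q2 w ^+ 2.
Let U w := u1 w ^+ 2 + u2 w ^+ 2.

(** The legendrian equation in real coordinates: u = u1 X + u2 Y for the horizontal fields X = d/dx
    + 2 y d/dt and Y = d/dy - 2 x d/dt. *)
Lemma tangent_t w : Om w -> (tangent w).2 = 2 * (w.1.2 * u1 w - w.1.1 * u2 w).
Proof.
move=> Ow; have := Psi_D Ow; have PE := PsiK Ow.
case E : (Psi w) => [s p] Dsp; rewrite E in PE.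
have [[_ leg] _ _] := curve_horizontal Dsp.2.
have := leg s Dsp.1; rewrite (zvelocity_curve Dsp) (derive1_curveE Dsp) PE => ->.
by rewrite /zcoord /u1 /u2; simpc => /=; ring.
Qed.

Lemma horizontal_pos w : Om w ->
  0 < q1 w * (u1 w ^+ 2 - u2 w ^+ 2) - q2 w * (2 * u1 w * u2 w) /\
  q1 w * (2 * u1 w * u2 w) + q2 w * (u1 w ^+ 2 - u2 w ^+ 2) = 0.
Proof.
move=> Ow; have := Psi_D Ow; have PE := PsiK Ow.
case E : (Psi w) => [s p] Dsp; rewrite E in PE.
have [_ _ hor] := curve_horizontal Dsp.2.
have := hor s Dsp.1; rewrite (zvelocity_curve Dsp) PE /zcoord /q1 /q2 -/(u1 w) -/(u2 w).
case: (q w) => c d; rewrite expr2; simpc => /= /andP[/eqP im re].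
split; first by apply: lt_le_trans re _; rewrite le_eqVlt; apply/orP; left; apply/eqP; ring.
by rewrite -im; ring.
Qed.

(** [N] is |q|^2, so the double root is |q|^(1/2), and the root of [U] is |u_z|. [A] and [B] are the
    horizontal components of W u. *)
Let W w := N w / (Num.sqrt (Num.sqrt (N w)) * Num.sqrt (U w)).
Let A w := W w * u1 w.
Let B w := W w * u2 w.

Lemma algebra_at w : Om w ->
  [/\ 0 < N w, 0 < U w, A w ^+ 2 - B w ^+ 2 = N w * q1 w & 2 * (A w * B w) = - (N w * q2 w)].
Proof. by move=> /horizontal_pos[h1 h2]; exact: unit_field_algebra. Qed.

Lemma W_gt0 w : Om w -> 0 < W w.
Proof. by move=> /algebra_at[N0 U0 _ _]; rewrite divr_gt0// mulr_gt0 ?sqrtr_gt0. Qed.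

Lemma AB_gt0 w : Om w -> 0 < A w ^+ 2 + B w ^+ 2.
Proof.
move=> Ow; have [N0 U0 _ _] := algebra_at Ow.
have -> : A w ^+ 2 + B w ^+ 2 = W w ^+ 2 * U w by rewrite /A /B /U; ring.
by apply: mulr_gt0 => //; apply: exprn_gt0; exact: W_gt0.
Qed.

Lemma q1_Cn1 : Cn 1 Om q1. Proof. by have [h _] := hq 1. Qed.

Lemma q2_Cn1 : Cn 1 Om q2. Proof. by have [_ h] := hq 1. Qed.

(** One of the two derivatives of [Phi] is spent here: u is a first derivative of [Phi] composed
    with [Psi], hence of class C^1. *)
Lemma tangent_Cn1 : Cn 1 Om u1 /\ Cn 1 Om u2.
Proof.
have [_ [_ cPhi] _] := hPhi; have c := cPhi e1.
have oD := open_D.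
split.
- apply: (@Cn1_comp_param _ _ Om D (fun x => ('D_e1 Phi x).1.1) Psi) => //.
  + by apply: Cn1_fst => //; apply: Cn1_fst.
  + exact: Psi_Cn1.
  + exact: Psi_D.
- apply: (@Cn1_comp_param _ _ Om D (fun x => ('D_e1 Phi x).1.2) Psi) => //.
  + by apply: Cn1_snd => //; apply: Cn1_fst.
  + exact: Psi_Cn1.
  + exact: Psi_D.
Qed.

Lemma Cn1_sqrt (f : heisenberg R -> R) : Cn 1 Om f -> (forall w, Om w -> 0 < f w) ->
  Cn 1 Om (fun w => Num.sqrt (f w)).
Proof.
move=> cf f0.
apply: (@Cn1_comp_real _ _ _ oOm Num.sqrt (fun y => (2 * Num.sqrt y)^-1)) => // w Ow.
- exact: (is_derive1_sqrt (f0 w Ow)).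
- apply: cvgV; first by rewrite mulf_neq0// gt_eqF// sqrtr_gt0 f0.
  by apply: cvgM; [exact: cvg_cst|exact: sqrt_continuous].
Qed.

Lemma Cn1_inv (f : heisenberg R -> R) : Cn 1 Om f -> (forall w, Om w -> 0 < f w) ->
  Cn 1 Om (fun w => (f w)^-1).
Proof.
move=> cf f0.
apply: (@Cn1_comp_real _ _ _ oOm (fun y => y^-1) (fun y => - y ^- 2)) => // w Ow.
- have f_neq0 : f w != 0 by rewrite gt_eqF// f0.
  have := @is_deriveV _ id (f w) 1 1 f_neq0 (is_derive_id _ _).
  by rewrite /GRing.scale/= mulr1.
- apply: cvgN; apply: cvgV; first by rewrite expf_neq0// gt_eqF// f0.
  exact: (cvgM cvg_id cvg_id).
Qed.

Lemma N_Cn1 : Cn 1 Om N.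
Proof. exact: (Cn1D oOm (Cn1M oOm q1_Cn1 q1_Cn1) (Cn1M oOm q2_Cn1 q2_Cn1)). Qed.

Lemma sqrt_NU_Cn1 : Cn 1 Om (fun w => Num.sqrt (Num.sqrt (N w))) /\
  Cn 1 Om (fun w => Num.sqrt (U w)).
Proof.
have [c1 c2] := tangent_Cn1.
have cU : Cn 1 Om U by exact: (Cn1D oOm (Cn1M oOm c1 c1) (Cn1M oOm c2 c2)).
have N0 w : Om w -> 0 < N w by move=> /algebra_at[].
have U0 w : Om w -> 0 < U w by move=> /algebra_at[].
have sN0 w : Om w -> 0 < Num.sqrt (N w) by move=> Ow; rewrite sqrtr_gt0 N0.
by split; [exact: (Cn1_sqrt (Cn1_sqrt N_Cn1 N0) sN0)|exact: (Cn1_sqrt cU U0)].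
Qed.

Lemma W_Cn1 : Cn 1 Om W.
Proof.
have [ca cv] := sqrt_NU_Cn1.
have den0 w : Om w -> 0 < Num.sqrt (Num.sqrt (N w)) * Num.sqrt (U w).
  by move=> /algebra_at[N0 U0 _ _]; rewrite mulr_gt0// !sqrtr_gt0.
exact: (Cn1M oOm N_Cn1 (Cn1_inv (Cn1M oOm ca cv) den0)).
Qed.

Lemma A_Cn1 : Cn 1 Om A.
Proof. exact: (Cn1M oOm W_Cn1 tangent_Cn1.1). Qed.

Lemma B_Cn1 : Cn 1 Om B.
Proof. exact: (Cn1M oOm W_Cn1 tangent_Cn1.2). Qed.

Lemma derive_mul (f g : heisenberg R -> R) w v : Cn 1 Om f -> Cn 1 Om g -> Om w ->
  'D_v (fun y => f y * g y) w = f w * 'D_v g w + g w * 'D_v f w.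
Proof.
move=> cf cg Ow.
exact: (deriveM (Cn1_derivable (v := v) cf Ow) (Cn1_derivable (v := v) cg Ow)).
Qed.

Lemma derive_add (f g : heisenberg R -> R) w v : Cn 1 Om f -> Cn 1 Om g -> Om w ->
  'D_v (fun y => f y + g y) w = 'D_v f w + 'D_v g w.
Proof.
move=> cf cg Ow.
exact: (deriveD (Cn1_derivable (v := v) cf Ow) (Cn1_derivable (v := v) cg Ow)).
Qed.

Lemma derive_N w v : Om w ->
  'D_v N w = 2 * q1 w * 'D_v q1 w + 2 * q2 w * 'D_v q2 w.
Proof.
move=> Ow; transitivity ('D_v (fun y => q1 y * q1 y + q2 y * q2 y) w); first by [].
rewrite (derive_add _ (Cn1M oOm q1_Cn1 q1_Cn1) (Cn1M oOm q2_Cn1 q2_Cn1) Ow).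
rewrite (derive_mul _ q1_Cn1 q1_Cn1 Ow) (derive_mul _ q2_Cn1 q2_Cn1 Ow).
by ring.
Qed.

(** The identity A^2 - B^2 = N q1 holds on an open set and may be differentiated there. This avoids
    differentiating the roots in [W]. *)
Lemma derive_real_identity w v : Om w ->
  2 * A w * 'D_v A w - 2 * B w * 'D_v B w = 'D_v N w * q1 w + N w * 'D_v q1 w.
Proof.
move=> Ow.
have -> : 'D_v N w * q1 w + N w * 'D_v q1 w = 'D_v (fun y => N y * q1 y) w.
  by rewrite (derive_mul _ N_Cn1 q1_Cn1 Ow); ring.
(* Subtraction is written with the constant function -1, so that the sum and product rules cover the
   whole computation. *)
have e : \near w, A w * A w + (fun=> -1) w * (B w * B w) = N w * q1 w.
  apply: (near_open oOm _ Ow) => y Oy; have [_ _ <- _] := algebra_at Oy.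
  by ring.
rewrite -(near_eq_derive v e).
have cAA := Cn1M oOm A_Cn1 A_Cn1; have cBB := Cn1M oOm B_Cn1 B_Cn1.
have c1 : Cn 1 Om (fun=> -1 : R) := Cn1_cst oOm (-1).
rewrite (derive_add _ cAA (Cn1M oOm c1 cBB) Ow) (derive_mul _ c1 cBB Ow).
rewrite (derive_mul _ A_Cn1 A_Cn1 Ow) (derive_mul _ B_Cn1 B_Cn1 Ow) (derive_cst (-1 : R)).
by ring.
Qed.

Lemma derive_imaginary_identity w v : Om w ->
  2 * (A w * 'D_v B w + B w * 'D_v A w) = - ('D_v N w * q2 w + N w * 'D_v q2 w).
Proof.
move=> Ow.
have -> : 'D_v N w * q2 w + N w * 'D_v q2 w = 'D_v (fun y => N y * q2 y) w.
  by rewrite (derive_mul _ N_Cn1 q2_Cn1 Ow); ring.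
have e : \near w, (fun=> -2) w * (A w * B w) = N w * q2 w.
  apply: (near_open oOm _ Ow) => y Oy; have [_ _ _ h] := algebra_at Oy.
  by rewrite -[RHS]opprK -h; ring.
rewrite -(near_eq_derive v e).
have cAB := Cn1M oOm A_Cn1 B_Cn1.
have c1 : Cn 1 Om (fun=> -2 : R) := Cn1_cst oOm (-2).
rewrite (derive_mul _ c1 cAB Ow) (derive_mul _ A_Cn1 B_Cn1 Ow) (derive_cst (-2 : R)).
by ring.
Qed.

Let ex : heisenberg R := ((1, 0), 0).
Let ey : heisenberg R := ((0, 1), 0).
Let et : heisenberg R := ((0, 0), 1).

Lemma B2_real w : Om w ->
  let X f := 'D_ex f w + 2 * w.1.2 * 'D_et f w in
  let Y f := 'D_ey f w - 2 * w.1.1 * 'D_et f w in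
  X N + q1 w * (X q1 - Y q2) + q2 w * (X q2 + Y q1) = 0 /\
  Y N + q1 w * (X q2 + Y q1) - q2 w * (X q1 - Y q2) = 0.
Proof.
move=> Ow X Y; have := hB2 Ow; rewrite /B2 /Zbar /dirderivC.
have -> : (fun u => complex.Re (`|q u| ^+ 2) : R) = N.
  by apply/funext => u; rewrite normCK_re_im.
have -> : (fun u => complex.Im (`|q u| ^+ 2) : R) = cst 0.
  by apply/funext => u; rewrite normCK_re_im.
rewrite !(derive_cst (0 : R)) -/q1 -/q2.
case E : (q w) => [c d]; have -> : q1 w = c by rewrite /q1 E.
have -> : q2 w = d by rewrite /q2 E.
exact: complex_B2_algebra.
Qed.

(** This is XA + YB = 0. It equals the Euclidean divergence of W u, because the t-component 2 (y A -
    x B) contributes 2 y dA/dt - 2 x dB/dt. *)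
Lemma divergence_free w : Om w ->
  ('D_ex A w + 2 * w.1.2 * 'D_et A w) + ('D_ey B w - 2 * w.1.1 * 'D_et B w) = 0.
Proof.
move=> Ow; have [r1 r2] := B2_real Ow.
have rx := derive_real_identity ex Ow; have ry := derive_real_identity ey Ow.
have rt := derive_real_identity et Ow.
have ix := derive_imaginary_identity ex Ow; have iy := derive_imaginary_identity ey Ow.
have it := derive_imaginary_identity et Ow.
rewrite !(derive_N _ Ow) in r1 r2 rx ry rt ix iy it.
exact: (divergence_algebra (AB_gt0 Ow) rx ry rt ix iy it r1 r2).
Qed.

(** Chain rule for [Psi \o Phi], the identity of [D]: in the chart [Psi] the field u becomes
    d/ds. *)
Lemma derive_Psi_tangent w : Om w -> 'D_(tangent w) Psi w = e1.
Proof.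
move=> Ow; have Dx := Psi_D Ow; set x := Psi w in Dx *.
have dPhi : differentiable Phi x := Cn1_differentiable Phi_Cn1 Dx.
have wE : Phi x = w := PsiK Ow.
have dPsi : differentiable Psi (Phi x) by rewrite wE; exact: (Cn1_differentiable Psi_Cn1 Ow).
transitivity ('D_e1 (Psi \o Phi) x).
  rewrite (deriveE _ (differentiable_comp dPhi dPsi)) (diff_comp dPhi dPsi).
  rewrite /= -(deriveE _ dPhi) -(deriveE _ dPsi) wE.
  by rewrite /tangent.
have e : \near x, id x = (Psi \o Phi) x.
  by apply: (near_open open_D _ Dx) => y Dy; rewrite /= PhiK.
by rewrite -(near_eq_derive e1 e) derive_id.
Qed.

Lemma Cn1_id (V : normedModType R) (E : set V) : open E -> Cn 1 E (id : V -> V).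
Proof.
move=> oE; apply: (Cn1_intro oE (df := fun v x => v)) => x.
- by move=> _; apply: (@linear_differentiable _ _ _ idfun) => y; exact: cvg_id.
- by move=> v _; exact: derive_id.
- by move=> v _; exact: cvg_cst.
Qed.

Lemma Cn1_comp_C1 (V : normedModType R) (E : set V) (h : R -> R) (f : V -> R) :
  open E -> C1 h -> Cn 1 E f -> Cn 1 E (fun x => h (f x)).
Proof.
move=> oE [h' ch' dh] cf.
have ch (y : R) : {for y, continuous h'} by exact: ch'.
exact: (Cn1_comp_real oE (fun x _ => dh (f x)) (fun x _ => ch (f x)) cf).
Qed.

(** * The weak form of the divergence identity *)

Section test_function.
Variables (a b c d e f : R) (phi phi' psi1 psi2 : R -> R).
Hypotheses (abI : `[a, b] `<=` I) (QL : `[c, d] `*` `[e, f] `<=` Lam).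
Hypothesis dphi : forall x : R, is_derive x 1 phi (phi' x).
Hypothesis cphi' : continuous phi'.
Hypothesis phi0 : forall x, ~ (a < x < b) -> phi x = 0.
Hypotheses (c1 : C1 psi1) (c2 : C1 psi2).
Hypotheses (b1 : bump_function c d psi1) (b2 : bump_function e f psi2).

Let k (x : R * (R * R)) : R := phi x.1 * (psi1 x.2.1 * psi2 x.2.2).
Let g w : R := k (Psi w).

Let box : set (R * (R * R)) := `[a, b]%classic `*` (`[c, d]%classic `*` `[e, f]%classic).

Lemma box_D : box `<=` D.
Proof. by move=> [s [p r]] [/= /abI Is pr]; split => //; exact: QL. Qed.

Lemma k_eq0 x : ~ box x -> k x = 0.
Proof.
move=> xbox; rewrite /k; have [|/phi0 ->] := pselect (a < x.1 < b); last by rewrite mul0r.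
have [|h _] := pselect (c < x.2.1 < d); last first.
  by have [_ _ ->] := b1; rewrite ?mul0r ?mulr0.
have [|h _ _] := pselect (e < x.2.2 < f); last first.
  by have [_ _ ->] := b2; rewrite ?mulr0.
move=> h3 h2 h1; exfalso; apply: xbox.
by split; [|split]; rewrite /= in_itv/=; case/andP: h1; case/andP: h2; case/andP: h3;
  move=> *; apply/andP; split; exact: ltW.
Qed.

Let fst1 := Cn1_fst (f := id) (@openT (R * (R * R))%type) (Cn1_id (@openT _)).
Let snd1 := Cn1_snd (f := id) (@openT (R * (R * R))%type) (Cn1_id (@openT _)).

Lemma k_Cn1 : Cn 1 setT k.
Proof.
have oT := @openT (R * (R * R))%type.
have p1 := Cn1_fst oT snd1; have p2 := Cn1_snd oT snd1.
have cphi : C1 phi by exists phi'.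
exact: (Cn1M oT (Cn1_comp_C1 oT cphi fst1)
  (Cn1M oT (Cn1_comp_C1 oT c1 p1) (Cn1_comp_C1 oT c2 p2))).
Qed.

Lemma derive_k x : 'D_e1 k x = phi' x.1 * (psi1 x.2.1 * psi2 x.2.2).
Proof.
have p : psi1 x.2.1 * psi2 x.2.2 = psi1 x.2.1 * psi2 x.2.2 by [].
have := @is_derive_line R _ _ k e1 (0, x.2) x.1.
have lineE (y : R) : y *: e1 + (0, x.2) = (y, x.2).
  case: (x.2) => p1 p2 /=.
  transitivity ((y * 1 + 0, (y * 0 + p1, y * 0 + p2)) : R * (R * R)); first by [].
  by rewrite !(mulr1, mulr0, addr0, add0r).
rewrite lineE; have -> : (x.1, x.2) = x by case: (x).
under eq_fun do rewrite lineE.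
have xT : [set: R * (R * R)] x by [].
move=> /(_ (Cn1_derivable k_Cn1 xT))[_ <-].
have := is_deriveM (dphi x.1) (is_derive_cst (psi1 x.2.1 * psi2 x.2.2) x.1 1).
by move=> [_ ->]; rewrite scaler0 add0r /GRing.scale/= mulrC.
Qed.

(** The t-component of W u, dictated by the contact condition. *)
Let C w := 2 * (w.1.2 * A w + (fun=> -1) w * (w.1.1 * B w)).

Lemma coordinates_Cn1 : Cn 1 Om (fun w : heisenberg R => w.1.1) /\
  Cn 1 Om (fun w : heisenberg R => w.1.2).
Proof.
have f1 := Cn1_fst oOm (Cn1_id oOm).
by split; [exact: (Cn1_fst oOm f1)|exact: (Cn1_snd oOm f1)].
Qed.

Lemma C_Cn1 : Cn 1 Om C.
Proof.
have [cx cy] := coordinates_Cn1.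
exact: (Cn1M oOm (Cn1_cst oOm 2) (Cn1D oOm (Cn1M oOm cy A_Cn1)
  (Cn1M oOm (Cn1_cst oOm (-1)) (Cn1M oOm cx B_Cn1)))).
Qed.

Lemma derive_t_coordinates w : 'D_et (fun w : heisenberg R => w.1.1) w = 0 /\
  'D_et (fun w : heisenberg R => w.1.2) w = 0.
Proof.
have did : differentiable (id : heisenberg R -> heisenberg R) w.
  exact: (Cn1_differentiable (Cn1_id (@openT _))).
have d1 : differentiable (fun y : heisenberg R => y.1) w := differentiable_fst_comp did.
by split; [rewrite (derive_fst _ d1)|rewrite (derive_snd _ d1)];
  rewrite (derive_fst _ did) derive_id.
Qed.

Lemma derive_C w : Om w -> 'D_et C w = 2 * (w.1.2 * 'D_et A w - w.1.1 * 'D_et B w).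
Proof.
move=> Ow; have [cx cy] := coordinates_Cn1; have [dx dy] := derive_t_coordinates w.
have cyA := Cn1M oOm cy A_Cn1; have cxB := Cn1M oOm cx B_Cn1.
have cm := Cn1_cst oOm (-1 : R); have cmxB := Cn1M oOm cm cxB.
rewrite (derive_mul _ (Cn1_cst oOm (2 : R)) (Cn1D oOm cyA cmxB) Ow).
rewrite (derive_add _ cyA cmxB Ow) (derive_mul _ cy A_Cn1 Ow) (derive_mul _ cm cxB Ow).
rewrite (derive_mul _ cx B_Cn1 Ow) dx dy !derive_cst.
by ring.
Qed.

Lemma g_Cn1 : Cn 1 Om g.
Proof. by apply: (Cn1_comp_param oOm k_Cn1 Psi_Cn1). Qed.

(** The left-hand side is the derivative of [g] along W u. Since [Psi] carries u to d/ds, it is [W]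
    times the s-derivative of [k]. *)
Lemma derive_g w : Om w ->
  A w * 'D_ex g w + B w * 'D_ey g w + C w * 'D_et g w =
  W w * (phi' (Psi w).1 * (psi1 (Psi w).2.1 * psi2 (Psi w).2.2)).
Proof.
move=> Ow; have dg := Cn1_differentiable g_Cn1 Ow.
have TE : W w *: tangent w = A w *: ex + B w *: ey + C w *: et.
  rewrite [tangent w]surjective_pairing [(tangent w).1]surjective_pairing (tangent_t Ow).
  rewrite -/(u1 w) -/(u2 w).
  transitivity (((A w * 1 + B w * 0 + C w * 0, A w * 0 + B w * 1 + C w * 0),
    A w * 0 + B w * 0 + C w * 1) : heisenberg R); last by [].
  rewrite !(mulr1, mulr0, addr0, add0r).
  transitivity (((W w * u1 w, W w * u2 w), W w * (2 * (w.1.2 * u1 w - w.1.1 * u2 w)))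
    : heisenberg R); first by [].
  by congr (_, _); rewrite /C /A /B; ring.
have <- : 'D_(W w *: tangent w) g w =
    W w * (phi' (Psi w).1 * (psi1 (Psi w).2.1 * psi2 (Psi w).2.2)).
  rewrite -derive_k (deriveE _ dg) linearZ -(deriveE _ dg).
  congr (W w * _); have xT : [set: R * (R * R)] (Psi w) by [].
  rewrite (derive_comp_param _ (Cn1_differentiable Psi_Cn1 Ow) (Cn1_differentiable k_Cn1 xT)).
  by rewrite (derive_Psi_tangent Ow).
by rewrite TE !(deriveE _ dg) !linearD !linearZ.
Qed.

(** The divergence of g W u is the derivative of [g] along W u plus [g] times the divergence of W u,
    and the latter is 0. *)
Lemma derive_flux w : Om w ->
  'D_ex (fun w => g w * A w) w + 'D_ey (fun w => g w * B w) w + 'D_et (fun w => g w * C w) w =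
  W w * (phi' (Psi w).1 * (psi1 (Psi w).2.1 * psi2 (Psi w).2.2)).
Proof.
move=> Ow; rewrite -(derive_g Ow).
rewrite (derive_mul _ g_Cn1 A_Cn1 Ow) (derive_mul _ g_Cn1 B_Cn1 Ow) (derive_mul _ g_Cn1 C_Cn1 Ow).
rewrite (derive_C Ow); have := divergence_free Ow.
move: ('D_ex A w) ('D_et A w) ('D_ey B w) ('D_et B w) ('D_ex g w) ('D_ey g w) ('D_et g w).
move: (A w) (B w) (C w) (g w) => A' B' C' g' ax at_ by_ bt gx gy gt dv.
transitivity (A' * gx + B' * gy + C' * gt +
  g' * (ax + 2 * w.1.2 * at_ + (by_ - 2 * w.1.1 * bt))); first by ring.
by rewrite dv; ring.
Qed.

Let K : set (heisenberg R) := Phi @` box.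

Lemma compact_K : compact K.
Proof.
apply: continuous_compact.
  apply: continuous_in_subspaceT => x; rewrite inE => xbox.
  exact: (Cn1_continuous Phi_Cn1 (box_D xbox)).
by apply: compact_setX; [|apply: compact_setX]; exact: segment_compact.
Qed.

Lemma closed_K : closed K.
Proof. by apply: compact_closed; [exact: norm_hausdorff|exact: compact_K]. Qed.

Lemma K_Om : K `<=` Om.
Proof. by move=> _ [x /box_D Dx <-]; exact: Phi_Om. Qed.

Lemma notin_box w : Om w -> ~ K w -> ~ box (Psi w).
Proof. by move=> Ow Kw xbox; apply: Kw; exists (Psi w) => //; exact: PsiK. Qed.

Lemma g_eq0 w : Om w -> ~ K w -> g w = 0.
Proof. by move=> Ow Kw; apply: k_eq0; exact: notin_box. Qed.

Lemma K_heis_box : exists M, forall w, ~ heis_box M w -> ~ K w.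
Proof.
have c1' : {in K, continuous (fun w : heisenberg R => w.1.1)}.
  move=> w _; exact: (continuous_comp (@continuous_fst _ _ w) (@continuous_fst _ _ w.1)).
have c2' : {in K, continuous (fun w : heisenberg R => w.1.2)}.
  move=> w _; exact: (continuous_comp (@continuous_fst _ _ w) (@continuous_snd _ _ w.1)).
have c3' : {in K, continuous (fun w : heisenberg R => w.2)}.
  move=> w _; exact: (@continuous_snd _ _ w).
have [M1 [M10 h1]] := compact_bound compact_K c1'.
have [M2 [M20 h2]] := compact_bound compact_K c2'.
have [M3 [M30 h3]] := compact_bound compact_K c3'.
exists (M1 + M2 + M3) => w wM Kw; apply: wM.
have := (h1 w Kw, h2 w Kw, h3 w Kw); rewrite !ler_norml.
move=> [[/andP[? ?] /andP[? ?]] /andP[? ?]].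
by split; [split|]; rewrite /= in_itv/=; apply/andP; split; lra.
Qed.

(** [h] vanishes off the compact set [K] inside [Om], so its extension by zero is differentiable
    along [v] on the whole space, with a continuous derivative of bounded support. Integrability is
    recorded because three such integrals will be added. *)
Lemma flux_integral (h : heisenberg R -> R) v : v = ex \/ v = ey \/ v = et ->
  Cn 1 Om h -> (forall w, Om w -> ~ K w -> h w = 0) ->
  (@lebesgue3 R).-integrable setT (EFin \o ((fun w => 'D_v h w) \_ Om)) /\
  (\int[@lebesgue3 R]_w (((fun w => 'D_v h w) \_ Om) w)%:E = 0)%E.
Proof.
move=> v123 ch h0; have [M MK] := K_heis_box; have cK := closed_K; have KO := K_Om.
pose G := h \_ Om.
have G0 w : ~ K w -> G w = 0 by exact: patch_eq0 h0 w.
have DG : (fun w => 'D_v G w) = (fun w => 'D_v h w) \_ Om.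
  exact: (patch_derive oOm cK KO h0 v).
have DG0 w : ~ K w -> 'D_v G w = 0 by exact: derive_support cK G0.
have cDG : continuous (fun w => 'D_v G w).
  rewrite DG; apply: (patch_continuous oOm cK KO).
    move=> w Ow Kw; have := DG0 w Kw; rewrite (congr1 (fun F => F w) DG) patchE.
    by rewrite mem_set.
  by move=> w; rewrite inE => Ow; exact: (@Cn1_derive_continuous _ _ Om _ h w v ch Ow).
rewrite -DG; split.
  by apply: (@integrable_heis _ _ M) => // w /MK; exact: DG0.
apply: (@integral_heis_derive R G M) => //.
- by move=> w /MK; exact: G0.
- apply: (patch_derivable oOm cK KO h0) => w Ow; exact: (Cn1_derivable ch Ow).
Qed.

(** The total integral of the divergence of g W u, taken one coordinate direction at a time. *)
Lemma weak_identity :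
  (\int[@lebesgue3 R]_w (((fun w => W w *
    (phi' (Psi w).1 * (psi1 (Psi w).2.1 * psi2 (Psi w).2.2))) \_ Om) w)%:E = 0)%E.
Proof.
have gh h w : Om w -> ~ K w -> g w * h w = 0.
  by move=> Ow Kw; rewrite g_eq0// mul0r.
have [i1 e1_] := flux_integral (or_introl erefl) (Cn1M oOm g_Cn1 A_Cn1) (gh A).
have [i2 e2_] := flux_integral (or_intror (or_introl erefl)) (Cn1M oOm g_Cn1 B_Cn1) (gh B).
have [i3 e3_] := flux_integral (or_intror (or_intror erefl)) (Cn1M oOm g_Cn1 C_Cn1) (gh C).
transitivity (\int[@lebesgue3 R]_w
  ((((fun w => 'D_ex (fun w => g w * A w) w) \_ Om) w)%:E +
   (((fun w => 'D_ey (fun w => g w * B w) w) \_ Om) w)%:E +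
   (((fun w => 'D_et (fun w => g w * C w) w) \_ Om) w)%:E))%E.
  apply: eq_integral => w _; rewrite -!EFinD !patchE.
  case: ifPn => [|_]; last by rewrite !addr0.
  by rewrite inE => Ow; rewrite (derive_flux Ow).
rewrite integralD//; last exact: integrableD.
by rewrite integralD// e1_ e2_ e3_ !adde0.
Qed.

End test_function.

(** * The image of the weighted measure in the parameter space *)

Let WOm : heis R -> R := W \_ Om.
(** The values of [Psi] outside [Om] are arbitrary. Patching each component makes the map measurable
    on the whole space, as an image measure requires. *)
Let PsiOm (w : heis R) : param R :=
  (((fun w => (Psi w).1) \_ Om) w,
   (((fun w => (Psi w).2.1) \_ Om) w, ((fun w => (Psi w).2.2) \_ Om) w)).

Lemma PsiOmE w : Om w -> PsiOm w = Psi w.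
Proof.
move=> Ow; rewrite /PsiOm !patchE mem_set//.
by case: (Psi w) => s [].
Qed.

Lemma continuous_Psi : [/\ {in Om, continuous (fun w => (Psi w).1)},
  {in Om, continuous (fun w => (Psi w).2.1)} & {in Om, continuous (fun w => (Psi w).2.2)}].
Proof.
have s1 := Cn1_fst oOm Psi_Cn1; have s2 := Cn1_snd oOm Psi_Cn1.
have s3 := Cn1_fst oOm s2; have s4 := Cn1_snd oOm s2.
split => w; rewrite inE => Ow.
- exact: (Cn1_continuous s1 Ow).
- exact: (Cn1_continuous s3 Ow).
- exact: (Cn1_continuous s4 Ow).
Qed.

Lemma measurable_Om : measurable (Om : set (heis R)).
Proof. exact: open_measurable_heisenberg. Qed.

Lemma measurable_patch_Om (h : heisenberg R -> R) : {in Om, continuous h} ->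
  measurable_fun setT (h \_ Om : heis R -> R).
Proof.
move=> ch; apply/(measurable_restrictT _ measurable_Om).
exact: open_continuous_measurable_heisenberg.
Qed.

Lemma measurable_PsiOm : measurable_fun setT PsiOm.
Proof.
have [c1 c2 c3] := continuous_Psi.
apply: measurable_fun_pair; first exact: measurable_patch_Om c1.
by apply: measurable_fun_pair; [exact: measurable_patch_Om c2|exact: measurable_patch_Om c3].
Qed.

Lemma measurable_WOm : measurable_fun setT WOm.
Proof.
apply: measurable_patch_Om => w; rewrite inE => Ow.
exact: (Cn1_continuous W_Cn1 Ow).
Qed.

Lemma WOm_ge0 w : 0 <= WOm w.
Proof. by rewrite /WOm patchE; case: ifPn => //; rewrite inE => /W_gt0/ltW. Qed.

Section invariance.
Variables (a b c d e f : R) (psi1 psi2 : R -> R).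
Hypotheses (abI : `[a, b] `<=` I) (QL : `[c, d] `*` `[e, f] `<=` Lam).
Hypotheses (c1 : C1 psi1) (c2 : C1 psi2).
Hypotheses (b1 : bump_function c d psi1) (b2 : bump_function e f psi2).

Let F eta w := W w * (eta (Psi w).1 * (psi1 (Psi w).2.1 * psi2 (Psi w).2.2)).

Lemma integrable_F eta : bump_function a b eta ->
  (@lebesgue3 R).-integrable setT (EFin \o (F eta \_ Om)).
Proof.
move=> [ceta eta0 etas]; have [M MK] := K_heis_box abI QL.
have cK := closed_K abI QL; have KO := K_Om abI QL.
have F0 w : Om w -> ~ (Phi @` (`[a, b]%classic `*` (`[c, d]%classic `*` `[e, f]%classic))) w ->
    F eta w = 0.
  move=> Ow Kw; rewrite /F (k_eq0 etas b1 b2) ?mulr0//.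
  exact: notin_box Kw.
have [cs cp cr] := continuous_Psi.
apply: (@integrable_heis _ _ M); last first.
  by move=> w /MK Kw; exact: (patch_eq0 F0 Kw).
apply: (patch_continuous oOm cK KO F0) => w wO.
have Ow : Om w by rewrite inE in wO.
apply: cvgM; first exact: (Cn1_continuous W_Cn1 Ow).
have ceta' : {for (Psi w).1, continuous eta} by exact: ceta.
have cpsi1 : {for (Psi w).2.1, continuous psi1} by exact: C1_continuous.
have cpsi2 : {for (Psi w).2.2, continuous psi2} by exact: C1_continuous.
apply: cvgM; first exact: (continuous_comp (cs w wO) ceta').
by apply: cvgM; [exact: (continuous_comp (cp w wO) cpsi1)|exact: (continuous_comp (cr w wO) cpsi2)].
Qed.

(** The difference [eta1 - eta2] has integral 0, hence is the derivative of a function supported in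
    the same interval; the weak identity applies to this primitive. *)
Lemma invariant_heis eta1 eta2 : bump_function a b eta1 -> bump_function a b eta2 ->
  (\int[lebesgue_measure]_s eta1 s = \int[lebesgue_measure]_s eta2 s)%R ->
  (\int[@lebesgue3 R]_w ((F eta1 \_ Om) w)%:E = \int[@lebesgue3 R]_w ((F eta2 \_ Om) w)%:E)%E.
Proof.
move=> be1 be2 e12; have [ce1 _ s1] := be1; have [ce2 _ s2] := be2.
pose eta x := eta1 x - eta2 x.
have ceta : continuous eta by move=> x; apply: cvgB; [exact: ce1|exact: ce2].
have etas x : ~ (a < x < b) -> eta x = 0 by move=> h; rewrite /eta s1// s2// subrr.
have eta0 : (\int[lebesgue_measure]_x eta x)%R = 0.
  rewrite RintegralB//; [|exact: bump_function_integrable be1|exact: bump_function_integrable be2].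
  by rewrite e12 subrr.
have [phi [dphi phi0]] := antiderivative_support ceta etas eta0.
have := weak_identity abI QL dphi ceta phi0 c1 c2 b1 b2.
have i1 := integrable_F be1; have i2 := integrable_F be2.
have -> : (\int[@lebesgue3 R]_w (((fun w => W w * (eta (Psi w).1 *
      (psi1 (Psi w).2.1 * psi2 (Psi w).2.2))) \_ Om) w)%:E =
    \int[@lebesgue3 R]_w (((F eta1 \_ Om) w)%:E - ((F eta2 \_ Om) w)%:E))%E.
  apply: eq_integral => w _; rewrite -EFinB !patchE; case: ifPn => _; last by rewrite subr0.
  by rewrite /F /eta; congr (_%:E); ring.
rewrite integralB// => /eqP; rewrite sube_eq ?integrable_fin_num// ?fin_num_adde_defl ?integrable_fin_num//.
by rewrite add0e => /eqP.
Qed.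

End invariance.

(** The image of W L^3 under [Psi]. The points outside [Om] all go to one default point, where they
    carry weight 0. *)
Lemma measure_along_trajectories : exists m : {measure set (param R) -> \bar R},
  forall k : param R -> \bar R, measurable_fun setT k -> (forall x, 0 <= k x)%E ->
  (\int[m]_x k x = \int[@lebesgue3 R]_(w in Om) (k (Psi w) * (W w)%:E))%E.
Proof.
have [m mE] := density_pushforward (@lebesgue3 R) measurable_PsiOm measurable_WOm WOm_ge0.
exists m => k mk k0; rewrite mE// [RHS]integral_mkcond.
apply: eq_integral => w _; rewrite patchE /WOm patchE; case: ifPn.
  by rewrite inE => Ow; rewrite PsiOmE.
by rewrite mule0.
Qed.

Section disintegrated.
Variable m : {measure set (param R) -> \bar R}.
Hypothesis mE : forall k : param R -> \bar R, measurable_fun setT k -> (forall x, 0 <= k x)%E ->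
  (\int[m]_x k x = \int[@lebesgue3 R]_(w in Om) (k (Psi w) * (W w)%:E))%E.

(** [W] is bounded on the image under [Phi] of the compact box, and that image is contained in a
    bounded cube. *)
Lemma trajectory_measure_box_lty (a b c d e f : R) : `[a, b] `<=` I -> `[c, d] `*` `[e, f] `<=` Lam ->
  (m (`[a, b] `*` (`[c, d] `*` `[e, f])) < +oo)%E.
Proof.
move=> abI QL; set B0 : set (param R) := `[a, b] `*` (`[c, d] `*` `[e, f]).
have mB : measurable B0.
  by apply: measurableX; [|apply: measurableX]; exact: measurable_itv.
have [M MK] := K_heis_box abI QL.
have cK := compact_K abI QL; have KO := K_Om abI QL.
have cW : {in Phi @` B0, continuous W}.
  by move=> w; rewrite inE => /KO Ow; exact: (Cn1_continuous W_Cn1 Ow).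
have [C [C0 WC]] := compact_bound cK cW.
have -> : m B0 = (\int[m]_x (\1_B0 x)%:E)%E by rewrite integral_indic// setIT.
rewrite mE; last 2 first.
- by apply/measurable_EFinP; exact: measurable_indic.
- by move=> x; rewrite lee_fin.
rewrite integral_mkcond.
pose h : heis R -> R := fun w => \1_B0 (PsiOm w) * WOm w.
have mh : measurable_fun setT h.
  apply: measurable_funM; last exact: measurable_WOm.
  apply: (measurableT_comp _ measurable_PsiOm); exact: measurable_indic.
have hE w : (((fun w => (\1_B0 (Psi w))%:E * (W w)%:E) \_ Om) w = (h w)%:E)%E.
  rewrite patchE /h /WOm patchE; case: ifPn => [|_]; last by rewrite mulr0.
  by rewrite inE => Ow; rewrite PsiOmE.
under eq_integral do rewrite hE.
have hC w : `|h w| <= C * \1_(heis_box M) w.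
  rewrite ger0_norm; last by rewrite mulr_ge0// WOm_ge0.
  have [Ow|Ow] := pselect (Om w); last first.
    by rewrite /h /WOm patchE memNset// mulr0 mulr_ge0.
  rewrite /h PsiOmE// /WOm patchE mem_set// !indicE.
  have [Bw|Bw] := pselect (B0 (Psi w)); last by rewrite memNset// mul0r mulr_ge0.
  have Kw : (Phi @` B0) w by exists (Psi w) => //; exact: PsiK.
  rewrite mem_set// mul1r (mem_set (A := heis_box M)); last first.
    by apply: contrapT => /MK; exact.
  by rewrite mulr1 (le_trans (ler_norm _))//; exact: WC.
have ih := integrable_bounded_support (heis_box_measurable M) (heis_box_lty M) mh hC.
have h0 w : (0 <= (h w)%:E)%E by rewrite lee_fin mulr_ge0// WOm_ge0.
have /integrableP[_] := ih.
by under eq_integral do rewrite gee0_abs ?h0//.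
Qed.

Lemma trajectory_measure_invariant (a b c d e f : R) (eta1 eta2 psi1 psi2 : R -> R) :
  `[a, b] `<=` I -> `[c, d] `*` `[e, f] `<=` Lam ->
  bump_function a b eta1 -> bump_function a b eta2 ->
  C1 psi1 -> bump_function c d psi1 -> C1 psi2 -> bump_function e f psi2 ->
  (\int[lebesgue_measure]_s eta1 s = \int[lebesgue_measure]_s eta2 s)%R ->
  (\int[m]_x (eta1 x.1 * (psi1 x.2.1 * psi2 x.2.2))%:E =
   \int[m]_x (eta2 x.1 * (psi1 x.2.1 * psi2 x.2.2))%:E)%E.
Proof.
move=> abI QL b1 b2 c1 p1 c2 p2 e12.
have int eta : bump_function a b eta ->
    (\int[m]_x (eta x.1 * (psi1 x.2.1 * psi2 x.2.2))%:E =
     \int[@lebesgue3 R]_w (((fun w => W w * (eta (Psi w).1 *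
       (psi1 (Psi w).2.1 * psi2 (Psi w).2.2))) \_ Om) w)%:E)%E.
  move=> [ceta eta0 _]; rewrite mE; last 2 first.
  - apply/measurable_EFinP; apply: measurable_funM; last apply: measurable_funM.
    + by apply: (@measurableT_comp _ _ _ _ (measurableTypeR R)); [exact: continuous_measurable_fun|].
    + apply: (@measurableT_comp _ _ _ _ (measurableTypeR R)).
        by apply: continuous_measurable_fun; have [] := p1.
      exact: (measurableT_comp measurable_fst measurable_snd).
    + apply: (@measurableT_comp _ _ _ _ (measurableTypeR R)).
        by apply: continuous_measurable_fun; have [] := p2.
      exact: (measurableT_comp measurable_snd measurable_snd).
  - have [_ h1 _] := p1; have [_ h2 _] := p2.
    by move=> x; rewrite lee_fin !mulr_ge0.
  rewrite integral_mkcond; apply: eq_integral => w _; rewrite !patchE.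
  by case: ifPn => // _; rewrite -EFinM mulrC.
rewrite (int _ b1) (int _ b2).
exact: (invariant_heis abI QL c1 c2 p1 p2 b1 b2 e12).
Qed.

End disintegrated.

(** * Integration along the curves *)

Lemma measurable_D : measurable (D : set (param R)).
Proof. by apply: open_measurable_param; exact: open_D. Qed.

Lemma measurable_Phi : measurable_fun (D : set (param R)) (Phi : param R -> heis R).
Proof.
have s1 := Cn1_fst open_D Phi_Cn1; have s2 := Cn1_snd open_D Phi_Cn1.
have s3 := Cn1_fst open_D s1; have s4 := Cn1_snd open_D s1.
have m (h : R * (R * R) -> R) : Cn 1 D h -> measurable_fun setT (h \_ D : param R -> R).
  move=> h1; apply/(measurable_restrictT _ measurable_D).
  apply: (open_continuous_measurable_param open_D) => x /set_mem Dx.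
  exact: (Cn1_continuous h1 Dx).
pose F (x : param R) : heis R :=
  ((((fun y => (Phi y).1.1) \_ D) x, ((fun y => (Phi y).1.2) \_ D) x),
   ((fun y => (Phi y).2) \_ D) x).
have mF : measurable_fun setT F.
  apply: measurable_fun_pair; last exact: m s2.
  by apply: measurable_fun_pair; [exact: m s3|exact: m s4].
apply: (eq_measurable_fun F).
  by move=> x Dx; rewrite /F !patchE Dx; case: (Phi x) => -[].
exact: measurable_funTS.
Qed.

Lemma measurable_comp_Phi d (T : measurableType d) (h : heis R -> T) :
  measurable_fun (Om : set (heis R)) h ->
  measurable_fun (D : set (param R)) (fun x => h (Phi x)).
Proof.
move=> mh; apply: (measurable_comp measurable_Om _ mh measurable_Phi).
by move=> _ [x Dx <-]; exact: Phi_Om.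
Qed.

Lemma measurable_heis (h : heisenberg R -> R) : Cn 1 Om h ->
  measurable_fun (Om : set (heis R)) h.
Proof.
move=> h1; apply: (open_continuous_measurable_heisenberg oOm) => w /set_mem Ow.
exact: (Cn1_continuous h1 Ow).
Qed.

(** The division by [W] cancels the weight put on L^3; the extension by zero makes the integrand a
    function on the whole parameter space. *)
Let line_density (h : heis R -> \bar R) : param R -> \bar R :=
  ((fun x => h (Phi x) * ((W (Phi x))^-1)%:E) \_ D)%E.

Lemma line_density_ge0 h x : (forall w, Om w -> 0 <= h w)%E -> (0 <= line_density h x)%E.
Proof.
move=> h0; rewrite /line_density patchE; case: ifPn => // /set_mem Dx.
by rewrite mule_ge0 ?h0 ?lee_fin ?invr_ge0 ?ltW ?W_gt0//; exact: Phi_Om.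
Qed.

Lemma measurable_line_density h : measurable_fun (Om : set (heis R)) h ->
  measurable_fun setT (line_density h).
Proof.
move=> mh; apply/(measurable_restrictT _ measurable_D).
apply: emeasurable_funM; first exact: measurable_comp_Phi.
apply/measurable_EFinP; apply: (measurable_comp_Phi (h := fun w => (W w)^-1)).
by apply: measurable_heis; apply: Cn1_inv; [exact: W_Cn1|exact: W_gt0].
Qed.

Lemma change_of_variables : exists nu : {sigma_finite_measure set (plane R) -> \bar R},
  forall h : heis R -> \bar R, measurable_fun (Om : set (heis R)) h ->
  (forall w, Om w -> 0 <= h w)%E ->
  (\int[@lebesgue3 R]_(w in Om) h w =
   \int[nu]_p \int[lebesgue_measure]_s line_density h (s, p))%E.
Proof.
have [m mE] := measure_along_trajectories.
have [nu nuE] := disintegration I0 oI iI oLam (trajectory_measure_box_lty mE) (trajectory_measure_invariant mE).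
exists nu => h mh h0.
have mk := measurable_line_density mh.
have k_ge0 x := line_density_ge0 x h0.
have <- : (\int[m]_x line_density h x = \int[@lebesgue3 R]_(w in Om) h w)%E.
  rewrite mE//; apply: eq_integral => w /set_mem Ow.
  have Dw := Psi_D Ow; rewrite /line_density patchE mem_set// PsiK// -muleA -EFinM.
  by rewrite mulVf ?mule1// gt_eqF// W_gt0.
apply: nuE => // x Dx.
by rewrite /line_density patchE memNset.
Qed.

(** The measure on the set of curves remains unspecified: an inequality valid on each curve
    integrates against any positive measure. *)
Lemma le_integral_trajectories (h1 h2 : heis R -> \bar R) :
  measurable_fun (Om : set (heis R)) h1 -> measurable_fun (Om : set (heis R)) h2 ->
  (forall w, Om w -> 0 <= h1 w)%E -> (forall w, Om w -> 0 <= h2 w)%E ->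
  (forall p, Lam p ->
    \int[lebesgue_measure]_(s in I) (h1 (Phi (s, p)) * ((W (Phi (s, p)))^-1)%:E) <=
    \int[lebesgue_measure]_(s in I) (h2 (Phi (s, p)) * ((W (Phi (s, p)))^-1)%:E))%E ->
  (\int[@lebesgue3 R]_(w in Om) h1 w <= \int[@lebesgue3 R]_(w in Om) h2 w)%E.
Proof.
move=> mh1 mh2 h10 h20 h12; have [nu nuE] := change_of_variables.
rewrite (nuE _ mh1 h10) (nuE _ mh2 h20).
have mG h : measurable_fun (Om : set (heis R)) h -> (forall w, Om w -> 0 <= h w)%E ->
    measurable_fun setT (fun p : plane R => \int[lebesgue_measure]_s line_density h (s, p))%E.
  move=> mh h0; have := @measurable_fun_fubini_tonelli_G _ _ _ _ R (@lebesgue_measure R)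
    (line_density h) (measurable_line_density mh).
  by apply=> x; exact: line_density_ge0.
apply: (ge0_le_integral nu measurableT _ (mG _ mh1 h10) (mG _ mh2 h20)).
  by move=> p _; apply: integral_ge0 => s _; exact: line_density_ge0.
move=> p _; have [Lp|Lp] := pselect (Lam p).
  have E h : (\int[lebesgue_measure]_s line_density h (s, p) =
      \int[lebesgue_measure]_(s in I) (h (Phi (s, p)) * ((W (Phi (s, p)))^-1)%:E))%E.
    rewrite [RHS]integral_mkcond; apply: eq_integral => s _; rewrite /line_density !patchE.
    by congr (if _ then _ else _); apply/idP/idP => /set_mem h3; apply/mem_set => //; case: h3.
  by rewrite !E; exact: h12.
have E h : (\int[lebesgue_measure]_s line_density h (s, p) = 0)%E.
  by apply: integral0_eq => s _; rewrite /line_density patchE memNset// => -[].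
by rewrite !E.
Qed.

(** * The extremal density *)

Let a w : R := Num.sqrt (Num.sqrt (N w)).
Let v w : R := Num.sqrt (U w).

Lemma normc_q w : Normc.normc (q w) = Num.sqrt (N w).
Proof. by rewrite /N /q1 /q2; case: (q w). Qed.

Lemma normc_zvelocity s p : I s -> Lam p ->
  Normc.normc (zvelocity (fun s => Phi (s, p)) s) = v (Phi (s, p)).
Proof. by move=> Is Lp; rewrite zvelocity_curve. Qed.

Lemma av_gt0 w : Om w -> 0 < a w /\ 0 < v w.
Proof. by move=> /algebra_at[N0 U0 _ _]; rewrite !sqrtr_gt0. Qed.

Lemma av_ge0 w : 0 <= a w * v w.
Proof. exact: (mulr_ge0 (sqrtr_ge0 _) (sqrtr_ge0 _)). Qed.

Lemma a4 w : Om w -> a w ^+ 4 = N w.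
Proof.
move=> /algebra_at[N0 _ _ _].
by rewrite (exprM _ 2 2) /a sqr_sqrtr ?sqrtr_ge0// sqr_sqrtr// ltW.
Qed.

(** Written with a = |q|^(1/2) and v = |u_z| alone, so that products with powers of [rho0] = a / L
    simplify as rational expressions. *)
Lemma invW w : Om w -> (W w)^-1 = a w * v w / a w ^+ 4.
Proof. by move=> Ow; rewrite /W invf_div a4. Qed.

Lemma measurable_av : measurable_fun (Om : set (heis R)) a /\ measurable_fun (Om : set (heis R)) v.
Proof. exact: (conj (measurable_heis sqrt_NU_Cn1.1) (measurable_heis sqrt_NU_Cn1.2)). Qed.

Lemma measurable_on_curve d (T : measurableType d) (h : heis R -> T) p : Lam p ->
  measurable_fun (Om : set (heis R)) h ->
  measurable_fun (I : set (measurableTypeR R)) (fun s => h (Phi (s, p))).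
Proof.
move=> Lp mh.
have mp : measurable_fun (I : set (measurableTypeR R)) (fun s => (s, p) : param R).
  by apply: measurable_funTS; exact: (@pair2_measurable _ _ (measurableTypeR R) (plane R) p).
apply: (measurable_comp measurable_D _ (measurable_comp_Phi mh) mp).
by move=> _ [s Is <-].
Qed.

Hypothesis hl : forall w, Om w -> (0 < l_Gamma q I Lam Phi w < +oo)%E.

Let L w := fine (l_Gamma q I Lam Phi w).

Lemma L_gt0 w : Om w -> 0 < L w.
Proof. by move=> /hl /andP[h1 h2]; rewrite fine_gt0// h1. Qed.

Lemma l_GammaE w : Om w -> l_Gamma q I Lam Phi w = (L w)%:E.
Proof. by move=> /hl /andP[h1 h2]; rewrite fineK// gt0_fin_numE. Qed.

Lemma q_lengthE p : Lam p -> q_length q I (fun s => Phi (s, p)) =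
  (\int[lebesgue_measure]_(s in I) (a (Phi (s, p)) * v (Phi (s, p)))%:E)%E.
Proof.
move=> Lp; apply: eq_integral => s /set_mem Is.
by rewrite normc_q normc_zvelocity.
Qed.

Lemma l_Gamma_curve s p : I s -> Lam p ->
  l_Gamma q I Lam Phi (Phi (s, p)) = q_length q I (fun s => Phi (s, p)).
Proof.
move=> Is Lp; rewrite /l_Gamma -/D -/Psi.
by have -> : Psi (Phi (s, p)) = (s, p) by exact: PhiK.
Qed.

(** The q-length depends on the curve only. A point of the nonempty [I] is chosen to read off its
    value, and the bounds on [l_Gamma] there make it positive and finite. *)
Lemma L_curve p : Lam p -> exists2 l : R, 0 < l & [/\ forall s, I s -> L (Phi (s, p)) = l &
  (\int[lebesgue_measure]_(s in I) (a (Phi (s, p)) * v (Phi (s, p)))%:E = l%:E)%E].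
Proof.
move=> Lp; have [s0 Is0] := I0; have O0 : Om (Phi (s0, p)) by exact: Phi_Om.
exists (L (Phi (s0, p))); first exact: L_gt0.
split; first by move=> s Is; rewrite /L !l_Gamma_curve.
by rewrite -(l_GammaE O0) (l_Gamma_curve Is0 Lp) (q_lengthE Lp).
Qed.

(** The q-length as a function of p is a partial integral, measurable by Tonelli, and [L] is its
    composition with the p-component of [Psi]. *)
Lemma measurable_L : measurable_fun (Om : set (heis R)) L.
Proof.
pose k : param R -> \bar R := ((fun x => (a (Phi x) * v (Phi x))%:E) \_ D)%E.
have [ma mv] := measurable_av.
have mk : measurable_fun setT k.
  apply/(measurable_restrictT _ measurable_D)/measurable_EFinP.
  exact: (measurable_comp_Phi (measurable_funM ma mv)).
have k0 x : (0 <= k x)%E.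
  by rewrite /k patchE; case: ifPn => // _; rewrite lee_fin mulr_ge0// sqrtr_ge0.
have mG := @measurable_fun_fubini_tonelli_G _ _ _ _ R (@lebesgue_measure R) k mk k0.
pose G (w : heis R) : R := fine (fubini_G (@lebesgue_measure R) k (PsiOm w).2).
have mGP : measurable_fun (Om : set (heis R)) G.
  apply: measurable_funTS; apply: measurableT_comp; first exact: fine_measurable.
  apply: (measurableT_comp mG); exact: (measurableT_comp measurable_snd measurable_PsiOm).
suff GL : {in (Om : set (heis R)), G =1 L} by exact: (eq_measurable_fun _ GL mGP).
move=> w /set_mem Ow; rewrite /G (PsiOmE Ow).
have [Is Lp] := Psi_D Ow; rewrite /L /l_Gamma -/D -/Psi (q_lengthE Lp) /fubini_G.
rewrite [in RHS]integral_mkcond; congr fine; apply: eq_integral => s _.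
rewrite /k !patchE.
by congr (if _ then _ else _); apply/idP/idP => /set_mem h3; apply/mem_set => //; case: h3.
Qed.

Let rho0 w : R := a w / L w.

Lemma measurable_rho0 : measurable_fun (Om : set (heis R)) rho0.
Proof.
apply: (measurable_funM measurable_av.1).
(* The inverse is taken as a real power, which agrees with it because [L] is positive on [Om]. *)
have mP : measurable_fun (Om : set (heis R)) (fun w => L w `^ (-1)).
  apply: (@measurableT_comp _ _ _ _ _ _ (fun x : R => x `^ (-1)) _ (L : heis R -> R)).
    exact: measurable_powR.
  exact: measurable_L.
apply: (eq_measurable_fun _ _ mP) => w /set_mem Ow.
by rewrite powR_inv1// ltW// L_gt0.
Qed.

Lemma rho0_gt0 w : Om w -> 0 < rho0 w.
Proof. by move=> Ow; rewrite divr_gt0 ?L_gt0//; exact: (av_gt0 Ow).1. Qed.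

Lemma rho0_integrand w : Om w ->
  ((rho0 w)%:E ^+ 4 = (Normc.normc (q w) ^+ 2)%:E / l_Gamma q I Lam Phi w ^+ 4)%E.
Proof.
move=> Ow; have L0 := L_gt0 Ow.
rewrite (l_GammaE Ow) -!EFin_expe inver gt_eqF ?exprn_gt0// -EFinM; congr (_%:E).
by rewrite expr_div_n (a4 Ow) normc_q sqr_sqrtr//; have [/ltW] := algebra_at Ow.
Qed.

Lemma measurable_curve_av p : Lam p ->
  measurable_fun (I : set (measurableTypeR R)) (fun s => (a (Phi (s, p)) * v (Phi (s, p)))%:E).
Proof.
move=> Lp; apply/measurable_EFinP; have [ma mv] := measurable_av.
exact: (measurable_on_curve Lp (measurable_funM ma mv)).
Qed.

Lemma measurable_I : measurable (I : set (measurableTypeR R)).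
Proof. exact: open_measurable. Qed.

Lemma integral_curve_scale p (l : R) : Lam p -> 0 <= l ->
  (\int[lebesgue_measure]_(s in I) (l * (a (Phi (s, p)) * v (Phi (s, p))))%:E =
   l%:E * \int[lebesgue_measure]_(s in I) (a (Phi (s, p)) * v (Phi (s, p)))%:E)%E.
Proof.
move=> Lp l0; under eq_integral do rewrite EFinM.
apply: (ge0_integralZl_EFin _ measurable_I _ (measurable_curve_av Lp) l0) => s _.
by rewrite lee_fin mulr_ge0// sqrtr_ge0.
Qed.

(** [L] is a constant l on each curve, so the [rho0]-length is the q-length divided by l, that is,
    exactly 1. *)
Lemma rho0_adm : adm Om (curve_family I Lam Phi) (fun w => (rho0 w)%:E).
Proof.
split.
- by apply/measurable_EFinP; exact: measurable_rho0.
- by move=> w /rho0_gt0; rewrite lee_fin => /ltW.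
move=> J gamma [p Lp [<- <-]]; have [l l0 [Ll lE]] := L_curve Lp.
have -> : (\int[lebesgue_measure]_(s in I) ((rho0 (Phi (s, p)))%:E *
    (Normc.normc (zvelocity (fun s => Phi (s, p)) s))%:E) =
    \int[lebesgue_measure]_(s in I) (l^-1 * (a (Phi (s, p)) * v (Phi (s, p))))%:E)%E.
  apply: eq_integral => s /set_mem Is; rewrite (normc_zvelocity Is Lp) -EFinM /rho0 (Ll s Is).
  by congr (_%:E); ring.
have li : 0 <= l^-1 by rewrite invr_ge0 ltW.
by rewrite (integral_curve_scale Lp li) lE -EFinM mulVf// gt_eqF.
Qed.

(** [young4] at c = [rho0] = a / L, multiplied by 1 / W = a v / a^4. The weight turns c^3 into v /
    L^3, so the linear term is the integrand of the [rho]-length, and c^4 into a v / L^4, a multiple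
    of the integrand of the q-length. *)
Lemma young_trajectory w (r : \bar R) : Om w -> (0 <= r)%E ->
  ((4 * L w ^- 3)%:E * (r * (v w)%:E) <=
   r ^+ 4 * ((W w)^-1)%:E + (3 * L w ^- 4 * (a w * v w))%:E)%E.
Proof.
move=> Ow r_ge0; have [a0 v0] := av_gt0 Ow; have L0 := L_gt0 Ow.
have rho0w : 0 <= rho0 w := ltW (rho0_gt0 Ow).
have W0 : (0 <= ((W w)^-1)%:E)%E by rewrite lee_fin invr_ge0; exact: (ltW (W_gt0 Ow)).
have := lee_wpmul2r W0 (young4 rho0w r_ge0); rewrite ge0_muleDl; last 2 first.
- exact: (expe_ge0 _ r_ge0).
- by rewrite lee_fin; exact: (mulr_ge0 (ler0n _ 3) (exprn_ge0 _ rho0w)).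
have e1' : (4 * rho0 w ^+ 3) * (W w)^-1 = 4 * L w ^- 3 * v w.
  by rewrite (invW Ow) /rho0; field; rewrite !gt_eqF.
have e2' : (3 * rho0 w ^+ 4) * (W w)^-1 = 3 * L w ^- 4 * (a w * v w).
  by rewrite (invW Ow) /rho0; field; rewrite !gt_eqF.
by rewrite muleAC -!EFinM e1' e2' EFinM -muleA (muleC (v w)%:E).
Qed.

Lemma measurable_expe4 (h : heis R -> \bar R) : measurable_fun (Om : set (heis R)) h ->
  measurable_fun (Om : set (heis R)) (fun w => h w ^+ 4)%E.
Proof.
move=> mh; have m4 := emeasurable_funM mh (emeasurable_funM mh (emeasurable_funM mh mh)).
by apply: (eq_measurable_fun _ _ m4) => w _; rewrite !expeS expe0 mule1.
Qed.

(** Let T be the [rho]-length, J the right-hand side and l the q-length of the curve. Integrating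
    [young_trajectory] gives 4 l^-3 T <= J + 3 l^-3, while the left-hand side equals l^-3. *)
Lemma rho0_curve_le (rho : heis R -> \bar R) p : Lam p ->
  adm Om (curve_family I Lam Phi) rho ->
  (\int[lebesgue_measure]_(s in I) ((rho0 (Phi (s, p)))%:E ^+ 4 * ((W (Phi (s, p)))^-1)%:E) <=
   \int[lebesgue_measure]_(s in I) (rho (Phi (s, p)) ^+ 4 * ((W (Phi (s, p)))^-1)%:E))%E.
Proof.
move=> Lp [mrho rho_ge0 rho_adm]; have [l l0 [Ll lE]] := L_curve Lp.
have Om_ s : I s -> Om (Phi (s, p)) by move=> Is; exact: Phi_Om.
have l4 : 0 <= l ^- 4 by rewrite invr_ge0 exprn_ge0// ltW.
have l34 : 0 <= 3 * l ^- 4 by rewrite mulr_ge0.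
have := rho_adm I (fun s => Phi (s, p)) (ex_intro2 _ _ p Lp erefl).
set T := (X in (1 <= X)%E) => T1.
have -> : (\int[lebesgue_measure]_(s in I) ((rho0 (Phi (s, p)))%:E ^+ 4 *
      ((W (Phi (s, p)))^-1)%:E) = (l ^- 3)%:E)%E.
  transitivity (\int[lebesgue_measure]_(s in I) (l ^- 4 * (a (Phi (s, p)) * v (Phi (s, p))))%:E)%E.
    apply: eq_integral => s /set_mem Is; have [a0 _] := av_gt0 (Om_ s Is).
    rewrite -EFin_expe -EFinM /rho0 (Ll s Is) (invW (Om_ s Is)); congr (_%:E).
    by field; rewrite !gt_eqF.
  rewrite (integral_curve_scale Lp l4) lE -EFinM; congr (_%:E).
  by field; rewrite gt_eqF.
set J := (X in (_ <= X)%E).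
(* Admissibility gives T >= 1, so 4 l^-3 <= J + 3 l^-3; the finite term 3 l^-3 can be subtracted
   even when J is infinite. *)
suff : ((4 * l ^- 3)%:E * T <= J + (3 * l ^- 3)%:E)%E.
  have h : ((4 * l ^- 3)%:E <= (4 * l ^- 3)%:E * T)%E.
    by rewrite -[leLHS]mule1 lee_pmul// lee_fin mulr_ge0// invr_ge0 exprn_ge0// ltW.
  move=> /(le_trans h); rewrite -leeBlDr// -EFinB.
  by have -> : 4 * l ^- 3 - 3 * l ^- 3 = l ^- 3 by ring.
have l3 : 0 <= 4 * l ^- 3 by rewrite mulr_ge0// invr_ge0 exprn_ge0// ltW.
have TE : T = (\int[lebesgue_measure]_(s in I) (rho (Phi (s, p)) * (v (Phi (s, p)))%:E))%E.
  by apply: eq_integral => s /set_mem Is; rewrite (normc_zvelocity Is Lp).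
have mrv : measurable_fun (I : set (measurableTypeR R))
    (fun s => rho (Phi (s, p)) * (v (Phi (s, p)))%:E)%E.
  apply: emeasurable_funM; first exact: (measurable_on_curve Lp mrho).
  by apply/measurable_EFinP; exact: (measurable_on_curve Lp measurable_av.2).
have rv0 s : I s -> (0 <= rho (Phi (s, p)) * (v (Phi (s, p)))%:E)%E.
  move=> Is; apply: mule_ge0; first exact: (rho_ge0 _ (Om_ s Is)).
  by rewrite lee_fin sqrtr_ge0.
have mJ : measurable_fun (I : set (measurableTypeR R))
    (fun s => rho (Phi (s, p)) ^+ 4 * ((W (Phi (s, p)))^-1)%:E)%E.
  apply: emeasurable_funM; first exact: (measurable_on_curve Lp (measurable_expe4 mrho)).
  apply/measurable_EFinP; apply: (measurable_on_curve Lp (h := fun w => (W w)^-1)).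
  by apply: measurable_heis; apply: Cn1_inv; [exact: W_Cn1|exact: W_gt0].
have J0 s : I s -> (0 <= rho (Phi (s, p)) ^+ 4 * ((W (Phi (s, p)))^-1)%:E)%E.
  move=> Is; apply: mule_ge0; first exact: (expe_ge0 _ (rho_ge0 _ (Om_ s Is))).
  by rewrite lee_fin invr_ge0 (ltW (W_gt0 (Om_ s Is))).
have -> : ((3 * l ^- 3)%:E = \int[lebesgue_measure]_(s in I)
    ((3 * l ^- 4) * (a (Phi (s, p)) * v (Phi (s, p))))%:E)%E.
  rewrite (integral_curve_scale Lp l34) lE -EFinM.
  by congr (_%:E); field; rewrite gt_eqF.
rewrite TE -(ge0_integralZl_EFin _ measurable_I rv0 mrv l3).
have mav : measurable_fun (I : set (measurableTypeR R))
    (fun s => ((3 * l ^- 4) * (a (Phi (s, p)) * v (Phi (s, p))))%:E).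
  under eq_fun do rewrite EFinM.
  by apply: measurable_funeM; exact: measurable_curve_av.
have av0 s : I s -> (0 <= ((3 * l ^- 4) * (a (Phi (s, p)) * v (Phi (s, p))))%:E)%E.
  by move=> _; rewrite lee_fin; exact: (mulr_ge0 l34 (av_ge0 _)).
rewrite -(ge0_integralD _ measurable_I J0 mJ av0 mav).
apply: (ge0_le_integral _ measurable_I).
- by move=> s Is; apply: mule_ge0; [rewrite lee_fin; exact: l3|exact: rv0].
- exact: measurable_funeM.
- exact: emeasurable_funD.
by move=> s Is; rewrite -(Ll s Is); exact: (young_trajectory (Om_ s Is) (rho_ge0 _ (Om_ s Is))).
Qed.

Lemma modulus4_trajectories : (modulus4 Om (curve_family I Lam Phi) =
  \int[@lebesgue3 R]_(w in Om)
    ((Normc.normc (q w) ^+ 2)%:E / l_Gamma q I Lam Phi w ^+ 4))%E.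
Proof.
have <- : (\int[@lebesgue3 R]_(w in Om) ((rho0 w)%:E ^+ 4) =
    \int[@lebesgue3 R]_(w in Om)
      ((Normc.normc (q w) ^+ 2)%:E / l_Gamma q I Lam Phi w ^+ 4))%E.
  by apply: eq_integral => w /set_mem Ow; exact: rho0_integrand.
apply/eqP; rewrite eq_le; apply/andP; split.
  by apply: ereal_inf_lbound; exists (fun w => (rho0 w)%:E) => //; exact: rho0_adm.
apply: le_ereal_inf_tmp => _ [rho rho_adm <-].
have [mrho rho_ge0 _] := rho_adm; have [mrho0 rho0_ge0 _] := rho0_adm.
apply: (le_integral_trajectories (measurable_expe4 mrho0) (measurable_expe4 mrho)).
- by move=> w Ow; exact: (expe_ge0 _ (rho0_ge0 _ Ow)).
- by move=> w Ow; exact: (expe_ge0 _ (rho_ge0 _ Ow)).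
- by move=> p Lp; exact: rho0_curve_le.
Qed.

End trajectories.

Theorem theorem2 (R : realType) (I : set R) (Lambda : set (R * R))
  (Omega : set (heisenberg R)) (Phi : R * (R * R) -> heisenberg R)
  (q : heisenberg R -> R[i])
  (hI0 : I !=set0) (hIopen : open I) (hIitv : is_interval I)
  (hLambda : open Lambda) (hOmega : open Omega)
  (hPhi : Cn_diffeomorphism 2 (I `*` Lambda) Omega Phi)
  (hleg : forall p, Lambda p -> legendrian I (fun s => Phi (s, p)))
  (hq : smoothC Omega q)
  (hB2 : forall w, Omega w -> B2 q w = 0)
  (hhor : forall J gamma, curve_family I Lambda Phi (J, gamma) ->
     horizontal_trajectory Omega q J gamma)
  (hl : forall w, Omega w -> (0 < l_Gamma q I Lambda Phi w < +oo)%E) :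
  (modulus4 Omega (curve_family I Lambda Phi) =
   \int[@lebesgue3 R]_(w in Omega)
     ((Normc.normc (q w) ^+ 2)%:E / l_Gamma q I Lambda Phi w ^+ 4))%E.
Proof. exact: modulus4_trajectories. Qed.
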